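(* (Model A) Suppose that either $d\in\{1,2\}$, or $d\ge3$ and $\mathbb{E}(\xi(0))\neq0$. Then the infinite-volume surface tension does not exist: for every $u\in\mathbb{R}^d$ and $\mathbb P$-almost every $\xi$, the limit $\lim_{N\to\infty}\sigma_{\Lambda_N}[\xi](u)$ does not exist as a real number.
   Context: Model A: $V\in C^2(\mathbb{R})$ is even, with $V(s)\ge As^2-B$ for all $s$ (some $A>0$, $B\in\mathbb{R}$) and $V''(s)\le C_2$ (some $C_2>0$). The disorder $(\xi(x))_{x\in\mathbb{Z}^d}$ is an i.i.d. family of real random variables with finite nonzero second moment, with law $\mathbb P$ and expectation $\mathbb E$. For finite $\Lambda\subset\mathbb{Z}^d$, $\partial\Lambda=\{x\notin\Lambda:\|x-y\|_1=1\text{ for some }y\in\Lambda\}$; for $\psi\in\mathbb{R}^{\mathbb{Z}^d}$, $$H^\psi_\Lambda[\xi](\phi)=\tfrac12\sum_{x,y\in\Lambda,|x-y|=1}V(\phi(x)-\phi(y))+\sum_{x\in\Lambda,y\in\partial\Lambda,|x-y|=1}V(\phi(x)-\psi(y))+\tfrac12\sum_{x\in\Lambda}\xi(x)\phi(x),$$ sums over ordered nearest-neighbour pairs, with $\phi=\psi$ off $\Lambda$. Let $\Lambda_N=[-N,N]^d\cap\mathbb{Z}^d$, $\psi_u(x)=x\cdot u$, $Z^{\psi_u}_{\Lambda_N}[\xi]=\int_{\mathbb{R}^{\Lambda_N}}\exp(-H^{\psi_u}_{\Lambda_N}[\xi](\phi))\prod_{x\in\Lambda_N}\mathrm{d}\phi(x)$,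 and the finite-volume surface tension $\sigma_{\Lambda_N}[\xi](u)=-\frac{1}{|\Lambda_N|}\log Z^{\psi_u}_{\Lambda_N}[\xi]$. *)

(* Defs.v *)
From HB Require Import structures.
From mathcomp Require Import all_boot all_order all_algebra.
From mathcomp Require Import all_classical all_reals all_analysis.
Set Implicit Arguments. Unset Strict Implicit. Unset Printing Implicit Defensive.
Import Order.TTheory GRing.Theory Num.Theory numFieldNormedType.Exports.
Local Open Scope ring_scope.
Local Open Scope classical_set_scope.

Definition site (d : nat) := {ffun 'I_d -> int}.

Definition origin (d : nat) : site d := [ffun => 0%Z].

Definition nbrs (d : nat) (x : site d) : seq (site d) :=
  flatten [seq [:: [ffun j => x j + (j == i)%:Z]%R;
                   [ffun j => x j - (j == i)%:Z]%R] | i <- enum 'I_d].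

Definition inbox (d N : nat) (x : site d) : bool :=
  [forall i, (- (N%:Z) <= x i)%R && (x i <= N%:Z)%R].

Definition box (d N : nat) : seq (site d) :=
  [seq [ffun i => (((f : {ffun 'I_d -> 'I_(N.*2.+1)}) i : nat)%:Z - N%:Z)%R] | f <- enum {ffun 'I_d -> 'I_(N.*2.+1)}].

Definition psi_u (R : realType) (d : nat) (u : 'rV[R]_d) (x : site d) : R :=
  \sum_(i < d) (x i)%:~R * u 0 i.

(** Hamiltonian H^psi_{Lambda_N}[xi](phi); only the values of phi on Lambda_N
    are used, the boundary values are those of psi. *)
Definition hamiltonian (R : realType) (d : nat) (V : R -> R) (N : nat)
  (xi : site d -> R) (psi : site d -> R) (phi : site d -> R) : R :=
  2^-1 * (\sum_(x <- box d N) \sum_(y <- nbrs x | inbox N y) V (phi x - phi y))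
  + (\sum_(x <- box d N) \sum_(y <- nbrs x | ~~ inbox N y) V (phi x - psi y))
  + 2^-1 * (\sum_(x <- box d N) xi x * phi x).

Definition upd (R : Type) (d : nat) (phi : site d -> R) (x : site d) (t : R) :
  site d -> R := fun y => if y == x then t else phi y.

(** Integral over R^s with respect to the product Lebesgue measure
    prod_{x in s} d phi(x), written as iterated Lebesgue integrals
    (equal to the product-measure integral by Tonelli, the integrands
    used below being nonnegative and continuous). Coordinates outside s
    keep the values of the starting configuration. *)
Fixpoint iint (R : realType) (d : nat) (s : seq (site d))
    (F : (site d -> R) -> \bar R) (phi : site d -> R) : \bar R :=
  match s with
  | [::] => F phi
  | x :: s' => (\int[@lebesgue_measure R]_(t in setT) iint s' F (upd phi x t))%E
  end.

Definition partition_fn (R : realType) (d : nat) (V : R -> R) (N : nat)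
  (xi : site d -> R) (u : 'rV[R]_d) : \bar R :=
  iint (box d N) (fun phi => (expR (- hamiltonian V N xi (psi_u u) phi))%:E)
       (psi_u u).

Definition surface_tension (R : realType) (d : nat) (V : R -> R) (N : nat)
  (xi : site d -> R) (u : 'rV[R]_d) : R :=
  - ln (fine (partition_fn V N xi u)) / ((N.*2.+1) ^ d)%:R.

Definition iid_field (R : realType) (dO : measure_display) (Omega : measurableType dO)
  (P : probability Omega R) (d : nat) (xi : site d -> Omega -> R) : Prop :=
  [/\ (forall x, measurable_fun setT (xi x)),
      (forall x (B : set R), measurable B ->
          P (xi x @^-1` B) = P (xi (origin d) @^-1` B)) &
      (forall (s : seq (site d)) (B : site d -> set R), uniq s ->
          (forall x, measurable (B x)) ->
          P (\big[setI/setT]_(x <- s) (xi x @^-1` B x))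
          = (\prod_(x <- s) P (xi x @^-1` B x))%E)].

(* Main.v *)
Require Import Defs.
From HB Require Import structures.
From mathcomp Require Import all_boot all_order all_algebra.
From mathcomp Require Import all_classical all_reals all_analysis.
From mathcomp Require Import measurable_realfun simple_functions measurable_fun_approximation.
From mathcomp Require Import lra ring zify.
Set Implicit Arguments. Unset Strict Implicit. Unset Printing Implicit Defensive.
Import Order.TTheory GRing.Theory Num.Theory numFieldNormedType.Exports.
Local Open Scope ring_scope.
Local Open Scope classical_set_scope.

(** Restricting the partition function to a unit cube of height fields around
    [psi_u + g], with [g] vanishing off the box, and using
    [V s <= V 0 + C2 s^2], gives for every such [g]
      [-log Z <= C |Lambda| + 3 C2 |grad g|^2 + (1/2) <xi, psi_u + g> + (1/2) |xi|_1].
    So it is enough to find, with probability close to one, a [g] (depending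
    on [xi]) for which the right-hand side is below [- k |Lambda|].
    If [E xi <> 0], a large constant of sign opposite to [E xi] works, since the
    energy of the boundary jump is of lower order than [|Lambda|].
    If [E xi = 0] and [d <= 2], take [g(x) = - eps sum_y f(x - y) b(xi y)], with [b]
    bounded, [E b(xi) = 0], [E (xi b(xi)) > 0], and [f] a truncated Green function:
    recurrence of the walk provides [f] with [f(0)] arbitrarily large and Dirichlet
    energy [O(f(0))]. The gain [eps f(0) |Lambda| E (xi b(xi))] beats the energy
    [O(eps^2 f(0) |Lambda|)], and the fluctuations are controlled by second moments,
    which is where the boundedness of [b] is needed. *)

(** * Iterated integrals *)

(** Only one side is estimated: almost surely the surface tension takes values below every [- k] at
    arbitrarily large [N], so the analysis rests on lower bounds for the partition function. Its
    finiteness matters too, since [fine] would turn an infinite value into 0. The obstacle is the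
    tilt term [sum_x xi x * psi_u u x]. Its sign is not controlled and its size is of order
    [N sqrt |Lambda|]: this exceeds [|Lambda|] for [d = 1] and is comparable to it for [d = 2]. The
    gain from [g] must therefore beat this noise as well as the energy, and this fixes the scales: a
    constant shift of order [sqrt N] when the mean is nonzero, and the choice of [f(0)] against [N]
    when it is zero. The gain in the zero mean case comes from the diagonal [x = y] of [<xi, g>].
    The off-diagonal part is a centred quadratic form; it is small because [f] has range [L] with
    the box of radius [L] a small fraction of [Lambda]. *)

(** The integral of a nonnegative function is a supremum over simple functions below it, so
    monotonicity needs no measurability. This allows iterated integrals to be compared without
    proving that the inner ones are measurable. *)
Lemma ge0_le_integralT (R : realType) d (T : measurableType d)
    (mu : {measure set T -> \bar R}) (f g : T -> \bar R) :
  (forall x, 0 <= f x)%E -> (forall x, f x <= g x)%E ->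
  (\int[mu]_x f x <= \int[mu]_x g x)%E.
Proof.
move=> f0 fg.
have g0 x : (0 <= g x)%E by exact: le_trans (fg x).
rewrite !ge0_integralTE//; apply: ub_ereal_sup => _ [h hf <-].
apply: ereal_sup_ubound; exists h => // x; exact: le_trans (fg x).
Qed.

Lemma iint_ge0 (R : realType) d (s : seq (site d)) (F : (site d -> R) -> \bar R) phi :
  (forall p, 0 <= F p)%E -> (0 <= iint s F phi)%E.
Proof.
move=> F0; elim: s phi => [|x s ih] phi //=.
by apply: integral_ge0 => t _; exact: ih.
Qed.

(** Each one-dimensional integral is cut down to an interval of length one, so the constant [c]
    passes through all of them unchanged. *)
Lemma iint_lb (R : realType) d (s : seq (site d)) (F : (site d -> R) -> \bar R)
    (h : site d -> R) (c : R) phi :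
  uniq s -> 0 <= c -> (forall p, 0 <= F p)%E ->
  (forall p, (forall x, x \notin s -> p x = phi x) ->
     (forall x, x \in s -> h x <= p x <= h x + 1) -> (c%:E <= F p)%E) ->
  (c%:E <= iint s F phi)%E.
Proof.
move=> + c0 F0; elim: s phi => [|x s ih] phi /=; first by move=> _; apply.
case/andP=> xs us H.
have ge0 t : (0 <= (c * \1_(`[h x, h x + 1]) t)%:E :> \bar R)%E.
  by rewrite lee_fin mulr_ge0// indicE.
have : (\int[@lebesgue_measure R]_t (c * \1_(`[h x, h x + 1]) t)%:E <=
        \int[@lebesgue_measure R]_t iint s F (upd phi x t))%E.
  apply: ge0_le_integralT => // t; rewrite indicE.
  case: (boolP (t \in _)) => [|_]; last by rewrite mulr0; exact: iint_ge0.
  rewrite mulr1 inE/= in_itv/= => ht; apply: ih => // p p1 p2.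
  apply: H => y.
    rewrite inE negb_or => /andP[yx ys].
    by rewrite p1// /upd (negbTE yx).
  rewrite inE; case: (boolP (y \in s)) => ys; first by move=> _; exact: p2.
  by rewrite orbF => /eqP ->; rewrite p1// /upd eqxx.
apply: le_trans; under eq_integral do rewrite EFinM.
rewrite ge0_integralZl_EFin//; last first.
  by apply/measurable_EFinP; exact: measurable_indic.
rewrite integral_indic// setIT.
have := lebesgue_measure_itv `[h x, h x + 1]%R.
rewrite /= lte_fin ltrDl ltr01 -EFinB addrAC subrr add0r => ->.
by rewrite mule1.
Qed.

(** A product bound lets the iterated integral factorise into powers of the integral of [w], again
    without measurability of [F]. *)
Lemma iint_ub (R : realType) d (s : seq (site d)) (F : (site d -> R) -> \bar R)
    (w : R -> R) (c : R) phi :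
  uniq s -> 0 <= c -> (forall p, 0 <= F p)%E ->
  (forall t, 0 <= w t) -> measurable_fun setT w ->
  (\int[@lebesgue_measure R]_t (w t)%:E < +oo)%E ->
  (forall p, (forall x, x \notin s -> p x = phi x) ->
     (F p <= (c * \prod_(x <- s) w (p x))%:E)%E) ->
  (iint s F phi < +oo)%E.
Proof.
move=> us c0 F0 w0 mw iw.
set I := (\int[lebesgue_measure]_t (w t)%:E)%E in iw.
have I0 : (0 <= I)%E by apply: integral_ge0 => t _; rewrite lee_fin.
have If : I \is a fin_num by rewrite ge0_fin_numE.
move=> H; suff : (iint s F phi <= (c * fine I ^+ size s)%:E)%E.
  by move/le_lt_trans; apply; rewrite ltry.
elim: s c c0 phi us H => [|x s ih] c c0 phi /=.
  by move=> _ /(_ phi (fun _ _ => erefl)); rewrite big_nil expr0.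
case/andP=> xs us H.
have : (\int[@lebesgue_measure R]_t iint s F (upd phi x t) <=
   \int[@lebesgue_measure R]_t ((c * fine I ^+ size s)%:E * (w t)%:E))%E.
  apply: ge0_le_integralT => t; first exact: iint_ge0.
  (* For the inner integrals the factor [w t] of the outer variable is a constant; it joins [c],
     which is why the induction is general in [c]. *)
  rewrite -EFinM mulrAC; apply: ih => //; first exact: mulr_ge0.
  move=> p hp; have := H p; rewrite big_cons mulrA => {}H.
  have -> : w t = w (p x) by rewrite hp// /upd eqxx.
  apply: H => y; rewrite inE negb_or => /andP[yx ys].
  by rewrite hp// /upd (negbTE yx).
move/le_trans; apply.
rewrite ge0_integralZl_EFin//.
- by rewrite -/I -(fineK If) -EFinM -mulrA exprSr.
- by move=> t _; rewrite lee_fin.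
- exact/measurable_EFinP.
- by rewrite mulr_ge0// exprn_ge0// fine_ge0.
Qed.

(** * The potential and the box *)

Lemma even_derive0 (R : realType) (V : R -> R) :
  (forall s, V (- s) = V s) -> (forall s, derivable V s 1) -> V^`() 0 = 0.
Proof.
move=> Ve Vd.
have HV : is_derive (- 0 : R) 1 V (V^`() 0).
  by rewrite oppr0 derive1E; exact: derivableP.
have HN : is_derive (0 : R) 1 (-%R : R -> R) (- 1).
  exact: is_deriveNid.
have := is_derive1_comp HV HN.
rewrite (_ : V \o -%R = V); last by apply/funext => s /=; rewrite Ve.
move=> [_]; rewrite -derive1E mulrN1 => /eqP; rewrite -addr_eq0 => /eqP ?; lra.
Qed.

(** Evenness gives [V'(0) = 0]; two applications of the mean value theorem then give
    [V s - V 0 = V''(c') c s] with [0 < c < s] for positive [s]. The factor 1/2 of Taylor's formula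
    is given away. *)
Lemma even_quadratic_ub (R : realType) (V : R -> R) (C2 : R) :
  (forall s, V (- s) = V s) ->
  (forall s, derivable V s 1) -> (forall s, derivable V^`() s 1) ->
  0 <= C2 -> (forall s, V^`(2) s <= C2) ->
  forall s, V s <= V 0 + C2 * s ^+ 2.
Proof.
move=> Ve Vd Vdd C2p V2.
have cont (f : R -> R) a b : (forall s, derivable f s 1) -> {within `[a, b], continuous f}.
  move=> fd; apply: continuous_subspaceT => x.
  by apply: differentiable_continuous; exact/derivable1_diffP.
have mvt (f : R -> R) s : (forall s, derivable f s 1) -> 0 < s ->
    exists2 c, 0 < c < s & f s - f 0 = derive1 f c * s.
  move=> fd s0; have [||c cs] := @MVT R f f^`() 0 s s0.
  - by move=> x _; rewrite derive1E; exact: derivableP.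
  - exact: cont.
  by rewrite subr0 => E; exists c => //; move: cs; rewrite in_itv.
have pos s : 0 < s -> V s <= V 0 + C2 * s ^+ 2.
  move=> s0; have [c /andP[c0 cs] E] := mvt V s Vd s0.
  have [c' _ E'] := mvt V^`() c Vdd c0.
  move: E'; rewrite even_derive0// subr0 => E'.
  have h2 := V2 c'; rewrite derive1nS derive1n1 in h2.
  have h3 : derive1 V c <= C2 * c by rewrite E' ler_wpM2r// ltW.
  have C0 : derive1 V c * s <= C2 * c * s by rewrite ler_wpM2r// ltW.
  have : C2 * c * s <= C2 * s * s by rewrite !ler_wpM2r ?ler_wpM2l// ltW.
  by rewrite expr2 mulrA => h4; lra.
move=> s; have [s0|s0|<-] := ltgtP 0 s.
- exact: pos.
- by rewrite -Ve -sqrrN; apply: pos; rewrite oppr_gt0.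
- by rewrite expr0n/= mulr0 addr0.
Qed.

Section box.
Variable d : nat.
Implicit Types x y : site d.

Lemma mem_box N x : (x \in box d N) = inbox N x.
Proof.
apply/mapP/forallP => [[f _ ->] i|H].
  by rewrite ffunE; move: (nat_of_ord (f i)) (ltn_ord (f i)) => m; lia.
have Hn i : (absz (x i + N%:Z)%R < N.*2.+1)%N by have := H i; lia.
exists [ffun i => Ordinal (Hn i)]; first by rewrite mem_enum.
apply/ffunP => i; rewrite !ffunE /=; have := H i; lia.
Qed.

Lemma uniq_box N : uniq (box d N).
Proof.
rewrite map_inj_uniq ?enum_uniq// => f g /ffunP fg.
apply/ffunP => i; have := fg i; rewrite !ffunE => E.
by apply/val_inj => /=; lia.
Qed.

Lemma size_box N : size (box d N) = (N.*2.+1 ^ d)%N.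
Proof. by rewrite size_map -cardE card_ffun !card_ord. Qed.

Lemma size_nbrs x : size (nbrs x) = (d.*2)%N.
Proof.
rewrite /nbrs size_flatten /shape -map_comp /=.
rewrite (eq_map (g := fun=> 2%N))// sumnE big_map big_const_seq count_predT.
by rewrite size_enum_ord iter_addn_0 mulnC muln2.
Qed.

Lemma nbrsP x y : reflect (exists2 i, (y = [ffun j => x j + (j == i)%:Z]%R) \/
     (y = [ffun j => x j - (j == i)%:Z]%R) & true) (y \in nbrs x).
Proof.
apply: (iffP flattenP) => [[s /mapP[i _ ->]]|[i H _]].
  by rewrite !inE => /orP[] /eqP ->; exists i => //; [left|right].
exists [:: [ffun j => x j + (j == i)%:Z]%R; [ffun j => x j - (j == i)%:Z]%R].
  by apply/mapP; exists i => //; rewrite mem_enum.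
by rewrite !inE; case: H => ->; rewrite eqxx ?orbT.
Qed.

Lemma inboxW N M x : (N <= M)%N -> inbox N x -> inbox M x.
Proof.
by move=> NM /forallP H; apply/forallP => i; have := H i; lia.
Qed.

Lemma inbox_nbrs N x y : inbox N x -> y \in nbrs x -> inbox N.+1 y.
Proof.
move=> /forallP H /nbrsP[i hi _]; apply/forallP => j; have := H j.
by case: hi => ->; rewrite ffunE; case: eqP; lia.
Qed.

Lemma nbrs_sym x y : y \in nbrs x -> x \in nbrs y.
Proof.
move=> /nbrsP[i hi _]; apply/nbrsP; exists i => //.
by case: hi => ->; [right|left]; apply/ffunP => j; rewrite !ffunE ?addrK ?subrK.
Qed.

Lemma psi_u_nbrs (R : realType) (u : 'rV[R]_d) x y : y \in nbrs x ->
  (psi_u u x - psi_u u y) ^+ 2 <= \sum_i (u 0 i) ^+ 2.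
Proof.
move=> /nbrsP[i hi _].
have -> : (psi_u u x - psi_u u y) ^+ 2 = (u 0 i) ^+ 2.
  (* The sign [e] of the step treats both neighbours in direction [i] at once. *)
  have [e he ye] : exists2 e : int, e ^+ 2 = 1 & forall j, y j = x j + e * (j == i)%:Z.
    by case: hi => ->; [exists 1|exists (-1)] => // j; rewrite ffunE; lia.
  rewrite /psi_u -sumrB (bigD1 i)//= big1 ?addr0.
    rewrite ye eqxx mulr1 rmorphD/= mulrDl opprD addrA subrr add0r sqrrN exprMn.
    by rewrite -rmorphXn/= he mul1r.
  by move=> j /negbTE ji; rewrite ye ji mulr0 addr0 subrr.
by rewrite (bigD1 i)//= lerDl sumr_ge0// => j _; exact: sqr_ge0.
Qed.

Lemma psi_u_box (R : realType) (u : 'rV[R]_d) N x : inbox N x ->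
  (psi_u u x) ^+ 2 <= (N%:R * \sum_i `|u 0 i|) ^+ 2.
Proof.
move=> /forallP H; rewrite -real_normK ?num_real// lerXn2r ?nnegrE//.
  by rewrite mulr_ge0// sumr_ge0.
apply: le_trans (ler_norm_sum _ _ _) _; rewrite mulr_sumr ler_sum// => i _.
rewrite normrM ler_wpM2r//; have := H i.
rewrite -intr_norm -[N%:R]/(N%:Z%:~R) ler_int; lia.
Qed.

(** The box is invariant under [x -> -x] and [psi_u] is odd. Consequently the mean of the disorder
    does not contribute to the tilt term. *)
Lemma sum_psi_u_box (R : realType) (u : 'rV[R]_d) N :
  \sum_(x <- box d N) psi_u u x = 0.
Proof.
pose opp (x : site d) : site d := [ffun i => - x i].
have oppK : involutive opp by move=> x; apply/ffunP => i; rewrite !ffunE opprK.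
have perm : perm_eq (box d N) (map opp (box d N)).
  apply: uniq_perm; rewrite ?(map_inj_uniq (inv_inj oppK)) ?uniq_box//.
  have oppb x : inbox N (opp x) = inbox N x.
    by apply: eq_forallb => i; rewrite ffunE; lia.
  move=> x; apply/idP/mapP => [hx|[y hy ->]].
    by exists (opp x); rewrite ?oppK// mem_box oppb -mem_box.
  by rewrite mem_box oppb -mem_box.
have E : \sum_(x <- box d N) psi_u u x = - \sum_(x <- box d N) psi_u u x.
  rewrite {1}(perm_big _ perm)/= big_map -sumrN; apply: eq_bigr => x _.
  by rewrite /psi_u -sumrN; apply: eq_bigr => i _; rewrite ffunE rmorphN mulNr.
by move/eqP: E; rewrite -addr_eq0 => /eqP E; lra.
Qed.

End box.

(** * Bounds on the partition function *)

Lemma gauss_integral_lty (R : realType) (c : R) : 0 < c ->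
  (* The integrand is a multiple of the centred normal density of variance [1 / (2 c)]. *)
  (\int[@lebesgue_measure R]_t (expR (- (c * t ^+ 2)))%:E < +oo)%E.
Proof.
move=> c0; pose s : R := Num.sqrt ((2 * c)^-1).
have s2 : s ^+ 2 = (2 * c)^-1 by rewrite sqr_sqrtr// invr_ge0 mulr_ge0// ltW.
have s0 : s != 0.
  by rewrite -sqrf_eq0 s2 invr_eq0 mulf_neq0// gt_eqF.
have pk := normal_peak_gt0 s0.
have /integrableP[mN iN] := integrable_normal_pdf (0 : R) s.
have E t : ((expR (- (c * t ^+ 2)))%:E =
    ((normal_peak s)^-1)%:E * `|(EFin \o normal_pdf 0 s) t|)%E.
  rewrite /= ger0_norm ?normal_pdf_ge0// -EFinM normal_pdfE//.
  rewrite mulKf ?gt_eqF// /normal_fun subr0.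
  congr (_%:E); congr expR; rewrite s2 mulNr; congr (- _).
  by rewrite mulr2n; field; rewrite gt_eqF.
under eq_integral do rewrite E.
rewrite ge0_integralZl_EFin//.
- by rewrite lte_mul_pinfty// lee_fin invr_ge0 ltW.
- exact: measurableT_comp.
- by rewrite invr_ge0 ltW.
Qed.

(** Dirichlet form over ordered edges that start in the box: inner edges count twice, edges leaving
    the box once. *)
Definition energy (R : realType) (d N : nat) (g : site d -> R) : R :=
  \sum_(x <- box d N) \sum_(y <- nbrs x) (g x - g y) ^+ 2.

Section partition_function.
Variables (R : realType) (d : nat).
Implicit Types (g p xi : site d -> R) (u : 'rV[R]_d).

Lemma energy_edge N p x y : inbox N x -> y \in nbrs x ->
  (p x - p y) ^+ 2 <= energy N p.
Proof.
move=> xN yx; rewrite /energy (big_rem x) ?mem_box//= (big_rem y)//=.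
rewrite -addrA lerDl addr_ge0//; first by apply: sumr_ge0 => z _; exact: sqr_ge0.
by do 2 (apply: sumr_ge0 => ? _); exact: sqr_ge0.
Qed.

Lemma energy_ge0 N p : 0 <= energy N p.
Proof. by do 2 (apply: sumr_ge0 => ? _); exact: sqr_ge0. Qed.

(* Follow the ray from [x] in a coordinate direction until it leaves the box. *)
Lemma sum_sqr_le_energy u N : (0 < d)%N ->
  exists2 K : R, 0 < K & forall p,
    (forall x, x \notin box d N -> p x = psi_u u x) ->
    \sum_(x <- box d N) p x ^+ 2 <= K * (energy N p + 1).
Proof.
move=> d0; pose i0 := Ordinal d0.
(* The first site of the ray off the box still lies in the box of radius [N + 1], where [Psi] bounds
   the boundary values. *)
pose Psi : R := N.+1%:R * \sum_i `|u 0 i|.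
have Psi0 : 0 <= Psi by rewrite mulr_ge0// sumr_ge0.
(* A ray that starts in the box has left it after at most [2 N + 1] steps. *)
pose k : R := (N.*2.+1)%:R.
pose n : R := (size (box d N))%:R.
have n0 : 0 <= n by exact: ler0n.
have k0 : 0 <= k by exact: ler0n.
pose K : R := n * (2 * Psi ^+ 2 + 2 * k ^+ 2) + 1.
have K0 : 0 < K.
  have h : 0 <= 2 * Psi ^+ 2 + 2 * k ^+ 2 by have := sqr_ge0 Psi; have := sqr_ge0 k; lra.
  by rewrite /K ltr_pwDr ?mulr_ge0.
exists K => // p pout.
pose S := Num.sqrt (energy N p).
have S0 : 0 <= S by exact: sqrtr_ge0.
have S2 : S ^+ 2 = energy N p by rewrite sqr_sqrtr// energy_ge0.
(* Here [j] bounds the number of steps left to the exit, and each step changes [p] by at most [S],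
   the square root of the energy. *)
have path j x : inbox N.+1 x -> (N%:Z + 1 <= x i0 + j%:Z)%R ->
    `|p x| <= Psi + j%:R * S.
  elim: j x => [|j ih] x xN1 hk; (have [xN|xN] := boolP (inbox N x); last first).
  - rewrite mul0r addr0 pout ?mem_box// -(@ler_pXn2r _ 2)// ?nnegrE//.
    by rewrite real_normK ?num_real// psi_u_box.
  - by move/forallP: xN => /(_ i0); lia.
  - rewrite pout ?mem_box//; apply: (@le_trans _ _ Psi); last first.
      by rewrite lerDl mulr_ge0.
    rewrite -(@ler_pXn2r _ 2)// ?nnegrE//.
    by rewrite real_normK ?num_real// psi_u_box.
  - pose y : site d := [ffun j => x j + (j == i0)%:Z].
    have yx : y \in nbrs x by apply/nbrsP; exists i0 => //; left.
    have : `|p y| <= Psi + j%:R * S.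
      apply: ih; first exact: inbox_nbrs yx.
      by rewrite ffunE eqxx; lia.
    have : `|p x - p y| <= S.
      rewrite -(@ler_pXn2r _ 2)// ?nnegrE// S2 real_normK ?num_real//.
      exact: energy_edge.
    have := ler_normD (p x - p y) (p y); rewrite subrK => h1 h2 h3.
    by rewrite -natr1 mulrDl mul1r; lra.
have bd x : x \in box d N -> p x ^+ 2 <= 2 * Psi ^+ 2 + 2 * k ^+ 2 * energy N p.
  rewrite mem_box => xN.
  have : `|p x| <= Psi + k * S.
    apply: path; first exact: inboxW xN.
    by move/forallP: xN => /(_ i0); lia.
  have kS : 0 <= Psi + k * S by apply: addr_ge0 => //; exact: mulr_ge0.
  rewrite -(@ler_pXn2r _ 2)// ?nnegrE//.
  rewrite real_normK ?num_real// -S2 => /le_trans; apply.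
  have := sqr_ge0 (Psi - k * S); rewrite -subr_ge0; nra.
have E0 := energy_ge0 N p.
apply: (@le_trans _ _ (\sum_(x <- box d N) (2 * Psi ^+ 2 + 2 * k ^+ 2 * energy N p))).
  by rewrite big_seq [leRHS]big_seq; apply: ler_sum => x; exact: bd.
rewrite big_const_seq count_predT iter_addr_0 -[_ *+ _]mulr_natl -/n.
have -> : n * (2 * Psi ^+ 2 + 2 * k ^+ 2 * energy N p) =
  n * (2 * Psi ^+ 2 + 2 * k ^+ 2) * (energy N p + 1) -
   (n * (2 * Psi ^+ 2) * energy N p + n * (2 * k ^+ 2)) by ring.
rewrite /K [leRHS]mulrDl mul1r.
have h1 : 0 <= n * Psi ^+ 2 * energy N p.
  by apply: mulr_ge0 => //; apply: mulr_ge0 => //; exact: sqr_ge0.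
have h2 : 0 <= n * k ^+ 2 by apply: mulr_ge0 => //; exact: sqr_ge0.
lra.
Qed.

Variables (V : R -> R) (A B C2 : R).
Hypotheses (A0 : 0 < A) (Vlb : forall s, A * s ^+ 2 - B <= V s).
Hypotheses (C20 : 0 <= C2) (Vub : forall s, V s <= V 0 + C2 * s ^+ 2).

Lemma hamiltonian_coercive u N xi : (0 < d)%N ->
  exists2 c : R, 0 < c & exists K : R, forall p,
  (forall x, x \notin box d N -> p x = psi_u u x) ->
  c * (\sum_(x <- box d N) p x ^+ 2) - K <= hamiltonian V N xi (psi_u u) p.
Proof.
move=> d0; have [Q Q0 HQ] := sum_sqr_le_energy u N d0.
pose T0 : R := \sum_(x <- box d N) \sum_(y <- nbrs x) `|B|.
(* Up to a constant, [(A / 2) * energy] dominates [2 c] times the sum of squares. One [c] pays for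
   the disorder by completing the square, the other remains. *)
pose c := A / (4 * Q).
have c0 : 0 < c by rewrite divr_gt0// mulr_gt0.
pose X := \sum_(x <- box d N) xi x ^+ 2.
exists c => //; exists (A / 2 + T0 + X / (16 * c)) => p pout.
have hE : 2^-1 * A * energy N p - T0 <=
  2^-1 * (\sum_(x <- box d N) \sum_(y <- nbrs x | inbox N y) V (p x - p y))
  + (\sum_(x <- box d N) \sum_(y <- nbrs x | ~~ inbox N y) V (p x - psi_u u y)).
  rewrite /energy /T0 !mulr_sumr -sumrB -big_split/=; apply: ler_sum => x _.
  rewrite !mulr_sumr -sumrB (bigID (inbox N))/=; apply: lerD; apply: ler_sum => y yN.
    have := Vlb (p x - p y); have := ler_norm B; have := normr_ge0 B; lra.
  rewrite -pout ?mem_box//.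
  have := Vlb (p x - p y); have := ler_norm B; have := sqr_ge0 (p x - p y).
  move: A0; nra.
have hX : - (c * \sum_(x <- box d N) p x ^+ 2) - X / (16 * c) <=
    2^-1 * (\sum_(x <- box d N) xi x * p x).
  suff : 0 <= c * (\sum_(x <- box d N) p x ^+ 2) + X / (16 * c) +
    2^-1 * (\sum_(x <- box d N) xi x * p x) by lra.
  rewrite /X mulr_suml !mulr_sumr -!big_split/=; apply: sumr_ge0 => x _.
  have -> : c * p x ^+ 2 + xi x ^+ 2 / (16 * c) + 2^-1 * (xi x * p x) =
     c * (p x + xi x / (4 * c)) ^+ 2 by field; rewrite gt_eqF.
  by apply: mulr_ge0; [exact: ltW|exact: sqr_ge0].
have := HQ p pout; set S := (\sum_(x <- box d N) p x ^+ 2) in hX *.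
have -> : Q * (energy N p + 1) = (2 * c)^-1 * (2^-1 * A * (energy N p + 1)).
  by rewrite /c; field; rewrite !gt_eqF.
have c2 : 0 < 2 * c by rewrite pmulr_rgt0.
rewrite ler_pdivlMl // => hS.
rewrite /hamiltonian; lra.
Qed.

(** Through [fine], an infinite partition function would enter [surface_tension] as 0 and a lower
    bound on it would say nothing. *)
Lemma partition_fn_lty u N xi : (0 < d)%N -> (partition_fn V N xi u < +oo)%E.
Proof.
move=> /(hamiltonian_coercive u N xi)[c c0 [K H]].
apply: (@iint_ub _ _ _ _ (fun t => expR (- (c * t ^+ 2))) (expR K)).
- exact: uniq_box.
- exact: expR_ge0.
- by move=> p; rewrite lee_fin expR_ge0.
- by move=> t; exact: expR_ge0.
- apply: measurableT_comp => //; apply: measurableT_comp => //.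
  by apply: measurable_funM => //; exact: measurable_funX.
- exact: gauss_integral_lty.
- move=> p /H hp; rewrite lee_fin -expR_sum -expRD ler_expR.
  by rewrite sumrN -mulr_sumr; lra.
Qed.

(** Edge cost per site that does not depend on [g]: [2 d] edges, each charged for the tilt and, by
    the summand 1, for the position inside the unit cube. The 3 comes from
    [(a + b + c)^2 <= 3 (a^2 + b^2 + c^2)]. *)
Definition vol_const u : R :=
  (d.*2)%:R * (`|V 0| + 3 * C2 * (\sum_i (u 0 i) ^+ 2 + 1)).

Lemma hamiltonian_ub u N xi g p :
  (forall x, ~~ inbox N x -> g x = 0) ->
  (forall x, x \notin box d N -> p x = psi_u u x) ->
  (forall x, x \in box d N -> psi_u u x + g x <= p x <= psi_u u x + g x + 1) ->
  hamiltonian V N xi (psi_u u) p <=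
   vol_const u * (N.*2.+1 ^ d)%:R + 3 * C2 * energy N g +
   2^-1 * (\sum_(x <- box d N) `|xi x| + \sum_(x <- box d N) xi x * psi_u u x
     + \sum_(x <- box d N) xi x * g x).
Proof.
move=> gout pout pin.
(* [tau] is the position inside the unit cube; off the box it is 0, so edges leaving the box obey
   the same bound. *)
pose tau x := p x - psi_u u x - g x.
have tau01 x : 0 <= tau x <= 1.
  rewrite /tau; have [xN|xN] := boolP (inbox N x).
    by have := pin x; rewrite mem_box => /(_ xN); lra.
  by rewrite gout// pout ?mem_box//; lra.
pose U := \sum_i (u 0 i) ^+ 2.
pose T x y : R := (`|V 0| + 3 * C2 * (U + 1)) + 3 * C2 * (g x - g y) ^+ 2.
have T0 x y : 0 <= T x y.
  have U0 : 0 <= U by apply: sumr_ge0 => i _; exact: sqr_ge0.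
  rewrite /T; have := normr_ge0 (V 0); have := mulr_ge0 C20 (sqr_ge0 (g x - g y)).
  have := mulr_ge0 C20 U0; move: C20; lra.
have VT x y : y \in nbrs x -> V (p x - p y) <= T x y.
  move=> yx; apply: le_trans (Vub _) _.
  have -> : p x - p y = (g x - g y) + (psi_u u x - psi_u u y) + (tau x - tau y).
    by rewrite /tau; ring.
  have h1 := psi_u_nbrs u yx; rewrite -/U in h1.
  have h2 : (tau x - tau y) ^+ 2 <= 1.
    have := tau01 x; have := tau01 y; nra.
  rewrite /T; move: h1 h2.
  move: (g x - g y) (psi_u u x - psi_u u y) (tau x - tau y) => a b c h1 h2.
  have h3 : (a + b + c) ^+ 2 <= 3 * (a ^+ 2 + U + 1).
    have := sqr_ge0 (a - b); have := sqr_ge0 (a - c); have := sqr_ge0 (b - c); nra.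
  have := ler_wpM2l C20 h3; have := ler_norm (V 0); lra.
have psi_out x y : y \in nbrs x -> ~~ inbox N y -> psi_u u y = p y.
  by move=> _ yN; rewrite pout// mem_box.
(* Inner edges are charged in full instead of by one half, so that they merge with the boundary
   edges into one sum over all neighbours. *)
have hE : 2^-1 * (\sum_(x <- box d N) \sum_(y <- nbrs x | inbox N y) V (p x - p y))
  + (\sum_(x <- box d N) \sum_(y <- nbrs x | ~~ inbox N y) V (p x - psi_u u y)) <=
   \sum_(x <- box d N) \sum_(y <- nbrs x) T x y.
  have -> : \sum_(x <- box d N) \sum_(y <- nbrs x) T x y =
    \sum_(x <- box d N) \sum_(y <- nbrs x | inbox N y) T x y +
    \sum_(x <- box d N) \sum_(y <- nbrs x | ~~ inbox N y) T x y.
    by rewrite -big_split; apply: eq_bigr => x _; rewrite (bigID (inbox N)).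
  apply: lerD.
    apply: (@le_trans _ _ (2^-1 * \sum_(x <- box d N) \sum_(y <- nbrs x | inbox N y) T x y)).
      rewrite ler_pM2l//; apply: ler_sum => x _.
      by rewrite big_seq_cond [leRHS]big_seq_cond; apply: ler_sum => y /andP[yx _]; exact: VT.
    suff : 0 <= \sum_(x <- box d N) \sum_(y <- nbrs x | inbox N y) T x y by lra.
    by do 2 (apply: sumr_ge0 => ? _).
  apply: ler_sum => x _; rewrite big_seq_cond [leRHS]big_seq_cond.
  by apply: ler_sum => y /andP[yx yN]; rewrite (psi_out x)//; exact: VT.
have hT : \sum_(x <- box d N) \sum_(y <- nbrs x) T x y =
    vol_const u * (N.*2.+1 ^ d)%:R + 3 * C2 * energy N g.
  rewrite /T /energy mulr_sumr.
  transitivity (\sum_(x <- box d N) (vol_const u + 3 * C2 * \sum_(y <- nbrs x) (g x - g y) ^+ 2)).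
    apply: eq_bigr => x _; rewrite big_split/= -mulr_sumr; congr (_ + _).
    by rewrite big_const_seq count_predT iter_addr_0 size_nbrs [RHS]mulr_natl.
  rewrite big_split/=; congr (_ + _).
  by rewrite big_const_seq count_predT iter_addr_0 size_box [RHS]mulr_natr.
have hxi : \sum_(x <- box d N) xi x * p x <=
  \sum_(x <- box d N) `|xi x| + \sum_(x <- box d N) xi x * psi_u u x
     + \sum_(x <- box d N) xi x * g x.
  rewrite -!big_split/=; apply: ler_sum => x _.
  have -> : p x = tau x + psi_u u x + g x by rewrite /tau; ring.
  move: (tau x) (tau01 x) => t /andP[t0 t1].
  rewrite !mulrDr !lerD2r; apply: le_trans (ler_norm _) _.
  by rewrite normrM (ger0_norm t0) ler_piMr.
rewrite /hamiltonian; lra.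
Qed.

Lemma surface_tension_ub u N xi g : (0 < d)%N ->
  (forall x, ~~ inbox N x -> g x = 0) ->
  surface_tension V N xi u * (N.*2.+1 ^ d)%:R <=
   vol_const u * (N.*2.+1 ^ d)%:R + 3 * C2 * energy N g +
   2^-1 * (\sum_(x <- box d N) `|xi x| + \sum_(x <- box d N) xi x * psi_u u x
     + \sum_(x <- box d N) xi x * g x).
Proof.
move=> d0 gout; set K := leRHS.
have n0 : (0 : R) < (N.*2.+1 ^ d)%:R by rewrite ltr0n expn_gt0.
rewrite /surface_tension divfK ?gt_eqF// lerNl.
have Zlb : ((expR (- K))%:E <= partition_fn V N xi u)%E.
  apply: (@iint_lb _ _ _ _ (fun x => psi_u u x + g x)).
  - exact: uniq_box.
  - exact: expR_ge0.
  - by move=> p; rewrite lee_fin expR_ge0.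
  - move=> p hp1 hp2; rewrite lee_fin ler_expR lerN2; exact: hamiltonian_ub.
have Zub := partition_fn_lty u N xi d0.
have Zf : partition_fn V N xi u \is a fin_num.
  by rewrite ge0_fin_numE// (le_trans _ Zlb)// lee_fin expR_ge0.
move: Zlb; rewrite -{1}(fineK Zf) lee_fin => Zlb.
have Z0 : 0 < fine (partition_fn V N xi u) by exact: lt_le_trans (expR_gt0 _) Zlb.
by rewrite -ler_expR lnK ?posrE.
Qed.

End partition_function.

(** * Independence and second moments *)

Section independence.
Variables (R : realType) (dO : measure_display) (Omega : measurableType dO)
  (P : probability Omega R).
Local Open Scope ereal_scope.
Import HBNNSimple.

(** Simple functions and monotone convergence carry the factorisation from indicators to nonnegative
    [h]. In the application [F] is the product of the other factors and [c] its expectation. *)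
Lemma ge0_integral_indic_ext (F : Omega -> R) (X : Omega -> R) (c : \bar R)
    (h : R -> R) :
  measurable_fun setT F -> (forall w, (0 <= F w)%R) -> measurable_fun setT X ->
  (forall B, measurable B ->
     \int[P]_w (F w * \1_B (X w))%:E = c * P (X @^-1` B)) ->
  measurable_fun setT h -> (forall t, (0 <= h t)%R) -> 0 <= c -> c \is a fin_num ->
  \int[P]_w (F w * h (X w))%:E = c * \int[P]_w (h (X w))%:E.
Proof.
move=> mF F0 mX HB mh h0 c0 cfin.
have mh' : measurable_fun setT (EFin \o h) by exact/measurable_EFinP.
pose a := nnsfun_approx measurableT mh'.
have acvg t : (EFin \o a^~ t) @ \oo --> (h t)%:E.
  by apply: (cvg_nnsfun_approx measurableT mh') => // ? _; rewrite lee_fin.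
have aX n : measurable_fun setT (a n \o X) by exact: measurableT_comp.
have simple n : \int[P]_w (F w * a n (X w))%:E = c * \int[P]_w (a n (X w))%:E.
  have mr r : measurable (a n @^-1` [set r]) by [].
  have mi r : measurable_fun setT (fun w => \1_(a n @^-1` [set r]) (X w) : R).
    have m1 : measurable_fun setT (\1_(a n @^-1` [set r]) : R -> R) by exact: measurable_indic.
    exact: measurableT_comp m1 mX.
  have r0 r w : (0 <= r * \1_(a n @^-1` [set r]) (X w))%R.
    have := nnfun_muleindic_ge0 (a n) r (X w); by rewrite lee_fin.
  have int1 : \int[P]_w (a n (X w))%:E =
      \sum_(r \in range (a n)) r%:E * P (X @^-1` (a n @^-1` [set r])).
    under eq_integral do rewrite fimfunE -fsumEFin//.
    rewrite ge0_integral_fsum//; last 2 first.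
    - by move=> r; apply/measurable_EFinP; exact: measurable_funM.
    - by move=> r w _; rewrite lee_fin.
    apply: eq_fsbigr => r /[!inE] -[t _ rt].
    have rge0 : (0 <= r)%R by rewrite -rt.
    under eq_integral do rewrite EFinM.
    rewrite ge0_integralZl_EFin//; last exact/measurable_EFinP.
    congr (_ * _); rewrite (_ : (fun w => _) = (fun w => (\1_(X @^-1` (a n @^-1` [set r])) w)%:E))//.
    by rewrite integral_indic ?setIT// -[X @^-1` _]setTI; exact: mX.
  rewrite int1 ge0_mule_fsumr; last first.
    move=> r; have [r0'|r0'] := leP 0%R r; first by rewrite mule_ge0.
    by rewrite preimage_nnfun0// preimage_set0 measure0 mule0.
  under eq_integral do rewrite fimfunE mulr_fsumr -fsumEFin//.
  rewrite ge0_integral_fsum//; last 2 first.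
  - by move=> r; apply/measurable_EFinP; do 2 apply: measurable_funM => //.
  - by move=> r w _; rewrite lee_fin mulr_ge0.
  apply: eq_fsbigr => r /[!inE] -[t _ rt].
  have rge0 : (0 <= r)%R by rewrite -rt.
  under eq_integral do rewrite mulrCA EFinM.
  rewrite ge0_integralZl_EFin//.
  - by rewrite HB// muleCA.
  - by move=> w _; rewrite lee_fin mulr_ge0.
  - by apply/measurable_EFinP; exact: measurable_funM.
have mono (G : Omega -> R) : measurable_fun setT G -> (forall w, (0 <= G w)%R) ->
    (fun n => \int[P]_w (G w * a n (X w))%:E) @ \oo --> \int[P]_w (G w * h (X w))%:E.
  move=> mG G0.
  rewrite (_ : \int[P]_w (G w * h (X w))%:E =
     \int[P]_w limn (fun n => (G w * a n (X w))%:E)); last first.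
    apply: eq_integral => w _; apply/esym/cvg_lim => //.
    rewrite EFinM; under eq_fun do rewrite EFinM.
    by apply: cvgeZl => //; exact: acvg.
  apply: cvg_monotone_convergence => //.
  - by move=> n; apply/measurable_EFinP; apply: measurable_funM => //; exact: aX.
  - by move=> n w _; rewrite lee_fin mulr_ge0.
  - move=> w _ m n mn; rewrite lee_fin ler_wpM2l//.
    by have /lefP := nd_nnsfun_approx measurableT mh' mn; exact.
have l2 : (fun n => \int[P]_w (a n (X w))%:E) @ \oo --> \int[P]_w (h (X w))%:E.
  have := mono (cst 1%R) (measurable_cst _) (fun=> ler01).
  by under eq_fun do under eq_integral do rewrite mul1r; under eq_integral do rewrite mul1r.
have l3 := cvgeZl cfin l2.
have := mono F mF F0; rewrite (funext simple) => l1.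
by apply: cvg_unique l1 l3.
Qed.

Variables (d : nat) (xi : site d -> Omega -> R).
Hypothesis xi_iid : iid_field P xi.

Let mxi x : measurable_fun setT (xi x). Proof. by case: xi_iid. Qed.

Lemma iid_integral_prod_indic (s : seq (site d)) (B : site d -> set R) :
  uniq s -> (forall x, measurable (B x)) ->
  \int[P]_w (\prod_(x <- s) \1_(B x) (xi x w))%:E =
  \prod_(x <- s) P (xi x @^-1` B x).
Proof.
move=> us mB; have [_ _ indep] := xi_iid; rewrite -indep//.
have mI : measurable (\big[setI/setT]_(x <- s) (xi x @^-1` B x)).
  by apply: big_rec => [//|x A _ mA]; apply: measurableI => //; rewrite -[_ @^-1` _]setTI; exact: mxi.
rewrite -[in RHS](setIT (\big[_/_]_(_ <- _) _)) -integral_indic//.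
apply: eq_integral => w _; congr (_%:E).
elim: (s) => [|x s' ih]; first by rewrite !big_nil indicT.
by rewrite !big_cons indicI ih.
Qed.

(** Factors are released one site at a time: those over [s2] are still indicators, those over [s1]
    already general. For the head [y] of [s1], the induction hypothesis is used with [h y] replaced
    by an indicator and [y] moved to [s2]. *)
Lemma ge0_iid_integral_prod (s1 s2 : seq (site d)) (h : site d -> R -> R) :
  uniq (s1 ++ s2) -> (forall x, measurable_fun setT (h x)) ->
  (forall x t, (0 <= h x t)%R) ->
  (forall x, \int[P]_w (h x (xi x w))%:E \is a fin_num) ->
  (forall x, x \in s2 -> exists2 B, measurable B & h x = \1_B) ->
  \int[P]_w (\prod_(x <- s1 ++ s2) h x (xi x w))%:E =
  \prod_(x <- s1 ++ s2) \int[P]_w (h x (xi x w))%:E.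
Proof.
elim: s1 s2 h => [|y s1 ih] s2 h /=.
  move=> us _ _ _ hB.
  pose B x := if pselect (exists2 B, measurable B & h x = \1_B) is left e
              then projT1 (cid2 e) else set0.
  have mB x : measurable (B x).
    by rewrite /B; case: pselect => // e; case: (cid2 e).
  have hE x : x \in s2 -> h x = \1_(B x).
    by move=> /hB e; rewrite /B; case: pselect => // e'; case: (cid2 e').
  transitivity (\int[P]_w (\prod_(x <- s2) \1_(B x) (xi x w))%:E).
    apply: eq_integral => w _; congr (_%:E).
    by rewrite big_seq [RHS]big_seq; apply: eq_bigr => x /hE ->.
  rewrite iid_integral_prod_indic// big_seq [RHS]big_seq; apply: eq_bigr => x /hE ->.
  have mx : measurable (xi x @^-1` B x) by rewrite -[_ @^-1` _]setTI; exact: mxi.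
  rewrite -[in LHS](setIT (xi x @^-1` B x)) -integral_indic//.
move=> /andP[ys us] mh h0 hfin hB.
rewrite big_cons.
have Ffin (s : seq (site d)) : \prod_(x <- s) \int[P]_w (h x (xi x w))%:E \is a fin_num.
  by elim: s => [|x s ihs]; rewrite ?big_nil// big_cons fin_numM.
have F0 (s : seq (site d)) : 0 <= \prod_(x <- s) \int[P]_w (h x (xi x w))%:E.
  elim: s => [|x s ihs]; rewrite ?big_nil ?lee_fin// big_cons mule_ge0//.
  by apply: integral_ge0 => w _; rewrite lee_fin.
under eq_integral do rewrite big_cons mulrC.
rewrite [RHS]muleC; apply: (@ge0_integral_indic_ext _ (xi y)) => //.
- by apply: measurable_prod => x _; exact: measurableT_comp.
- by move=> w; apply: prodr_ge0.
move=> B mB.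
pose h' x := if x == y then \1_B else h x.
have h'E x : x \in s1 ++ s2 -> h' x = h x.
  by rewrite /h'; case: eqP => // -> ys'; rewrite ys' in ys.
have perm : perm_eq (s1 ++ y :: s2) (y :: s1 ++ s2).
  by rewrite -cat_rcons perm_sym -cat_cons perm_cat2r perm_sym perm_rcons.
have us' : uniq (s1 ++ y :: s2).
  by rewrite (perm_uniq perm)/= ys.
have := ih (y :: s2) h' us'.
rewrite (perm_big _ perm)/= big_cons.
under eq_integral do rewrite (perm_big _ perm)/= big_cons.
have -> : \prod_(j <- s1 ++ s2) \int[P]_w (h' j (xi j w))%:E =
   \prod_(j <- s1 ++ s2) \int[P]_w (h j (xi j w))%:E.
  by rewrite big_seq [RHS]big_seq; apply: eq_bigr => x /h'E ->.
have -> : (fun w => (h' y (xi y w) * \prod_(j <- s1 ++ s2) h' j (xi j w))%:E) =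
  (fun w => (\prod_(j <- s1 ++ s2) h j (xi j w) * \1_B (xi y w))%:E).
  apply/funext => w; rewrite mulrC {2}/h' eqxx; congr (_ * _)%:E.
  by rewrite big_seq [RHS]big_seq; apply: eq_bigr => x /h'E ->.
have hy : \int[P]_w (h' y (xi y w))%:E = P (xi y @^-1` B).
  rewrite /h' eqxx -[in RHS](setIT (xi y @^-1` B)) -integral_indic//.
  by rewrite -[_ @^-1` _]setTI; exact: mxi.
rewrite hy muleC => -> //.
- by move=> x; rewrite /h'; case: eqP.
- by move=> x t; rewrite /h'; case: eqP.
- move=> x; rewrite /h'; case: eqP => // -> ; rewrite -/(h' y).
  rewrite (_ : (fun w => _) = (fun w => (h' y (xi y w))%:E)) ?hy.
    by rewrite fin_num_measure//  -[_ @^-1` _]setTI; exact: mxi.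
  by apply/funext => w; rewrite /h' eqxx.
- move=> x; rewrite inE /h'; case: eqP => [-> _|_ /= xs2]; first by exists B.
  exact: hB.
Qed.
End independence.

Section expectation.
Variables (R : realType) (dO : measure_display) (Omega : measurableType dO)
  (P : probability Omega R) (d : nat) (xi : site d -> Omega -> R).
Hypothesis xi_iid : iid_field P xi.

Let mxi x : measurable_fun setT (xi x). Proof. by case: xi_iid. Qed.

Local Notation L1 f := (P.-integrable setT (EFin \o f)).

Lemma integrableW (f g : Omega -> R) : measurable_fun setT f ->
  (forall w, `|f w| <= g w) -> L1 g -> L1 f.
Proof.
move=> mf fg ig; apply: le_integrable ig => //; first exact/measurable_EFinP.
by move=> w _; rewrite lee_fin; apply: le_trans (fg w) (ler_norm _).
Qed.

Lemma ge0_integrableP (f : Omega -> R) : measurable_fun setT f ->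
  (forall w, 0 <= f w) -> L1 f <-> (\int[P]_w (f w)%:E \is a fin_num)%E.
Proof.
move=> mf f0; split=> [/integrable_fin_num -> //|If].
apply/integrableP; split; first exact/measurable_EFinP.
under eq_integral do rewrite /= ger0_norm//.
by rewrite ltey_eq If.
Qed.

(** The nonnegative factorisation, applied to the absolute values, gives a finite product. *)
Lemma iid_integrable_prod (s : seq (site d)) (h : site d -> R -> R) :
  uniq s -> (forall x, measurable_fun setT (h x)) ->
  (forall x, L1 (h x \o xi x)) ->
  L1 (fun w => \prod_(x <- s) h x (xi x w)).
Proof.
move=> us mh ih.
have mhx x : measurable_fun setT (h x \o xi x) by exact: measurableT_comp.
have mp : measurable_fun setT (fun w => \prod_(x <- s) h x (xi x w)).
  by apply: measurable_prod => x _; exact: mhx.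
have ihn x : (\int[P]_w (`|h x (xi x w)|)%:E \is a fin_num)%E.
  have mn : measurable_fun setT (fun w => `|h x (xi x w)|) by exact: measurableT_comp (mhx x).
  apply/(ge0_integrableP mn) => //; exact: integrable_norm (ih x).
apply: (@integrableW _ (fun w => \prod_(x <- s) `|h x (xi x w)|)) => //.
  by move=> w; rewrite normr_prod.
have mpn : measurable_fun setT (fun w => \prod_(x <- s) `|h x (xi x w)|).
  by apply: measurable_prod => x _; exact: measurableT_comp (mhx x).
apply/(ge0_integrableP mpn); first by move=> w; apply: prodr_ge0.
have := @ge0_iid_integral_prod _ _ _ _ _ _ xi_iid s [::] (fun x t => `|h x t|).
rewrite cats0 => -> //; last by move=> x; exact: measurableT_comp.
by elim: (s) => [|x s' ihs]; rewrite ?big_nil// big_cons fin_numM.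
Qed.

Lemma ge0_iid_Rintegral_prod (s : seq (site d)) (h : site d -> R -> R) :
  uniq s -> (forall x, measurable_fun setT (h x)) ->
  (forall x, L1 (h x \o xi x)) -> (forall x, x \in s -> forall t, 0 <= h x t) ->
  \int[P]_w (\prod_(x <- s) h x (xi x w)) = \prod_(x <- s) \int[P]_w (h x (xi x w)).
Proof.
move=> us mh ih h0.
(* Off [s] the functions may change sign; setting them to 0 there meets the global sign condition of
   the previous result. *)
pose h' x t := if x \in s then h x t else 0.
have h'E x : x \in s -> h' x = h x by move=> xs; apply/funext => t; rewrite /h' xs.
have mh' x : measurable_fun setT (h' x).
  by have [/h'E ->//|xs] := boolP (x \in s); rewrite /h' (negbTE xs).
have h'0 x t : 0 <= h' x t by rewrite /h'; case: ifP => // /h0.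
have fin x : (\int[P]_w (h' x (xi x w))%:E \is a fin_num)%E.
  have mc : measurable_fun setT (fun w => h' x (xi x w)) by exact: measurableT_comp (mh' x) (mxi x).
  apply/(ge0_integrableP mc) => //.
  have [/h'E ->|xs] := boolP (x \in s); first exact: ih.
  rewrite /h' (negbTE xs); exact: finite_measure_integrable_cst.
have := @ge0_iid_integral_prod _ _ _ _ _ _ xi_iid s [::] h'.
rewrite cats0 => /(_ us mh' h'0 fin) H.
transitivity (\int[P]_w (\prod_(x <- s) h' x (xi x w))).
  congr fine; apply: eq_integral => w _; congr (_%:E).
  by rewrite big_seq [RHS]big_seq; apply: eq_bigr => x /h'E ->.
rewrite /Rintegral H //.
transitivity (\prod_(x <- s) fine (\int[P]_w (h' x (xi x w))%:E)%E); last first.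
  by rewrite big_seq [RHS]big_seq; apply: eq_bigr => x /h'E ->.
elim: (s) => [|x s' ihs]; rewrite ?big_nil// !big_cons fineM ?ihs//.
by elim: (s') => [|z s'' ihs']; rewrite ?big_nil// big_cons fin_numM.
Qed.

(** The same release of one site at a time, now for signs: factors over [s2] are nonnegative, those
    over [s1] arbitrary. The head factor is split into positive and negative parts, each of which
    may be moved to [s2]. *)
Lemma iid_Rintegral_prod_cat (s1 s2 : seq (site d)) (h : site d -> R -> R) :
  uniq (s1 ++ s2) -> (forall x, measurable_fun setT (h x)) ->
  (forall x, L1 (h x \o xi x)) -> (forall x, x \in s2 -> forall t, 0 <= h x t) ->
  \int[P]_w (\prod_(x <- s1 ++ s2) h x (xi x w)) =
  \prod_(x <- s1 ++ s2) \int[P]_w (h x (xi x w)).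
Proof.
elim: s1 s2 h => [|y s1 ih] s2 h; first exact: ge0_iid_Rintegral_prod.
move=> /= /andP[ys us] mh ih1 h0.
pose upd' (f : R -> R) x := if x == y then f else h x.
have h'E f x : x \in s1 ++ s2 -> upd' f x = h x.
  by rewrite /upd'; case: eqP => // -> ys'; rewrite ys' in ys.
have perm : perm_eq (s1 ++ y :: s2) (y :: s1 ++ s2).
  by rewrite -cat_rcons perm_sym -cat_cons perm_cat2r perm_sym perm_rcons.
have us' : uniq (s1 ++ y :: s2) by rewrite (perm_uniq perm)/= ys.
have prodE f w : \prod_(x <- y :: s1 ++ s2) upd' f x (xi x w) =
    f (xi y w) * \prod_(x <- s1 ++ s2) h x (xi x w).
  rewrite big_cons /upd' eqxx; congr (_ * _).
  by rewrite big_seq [RHS]big_seq; apply: eq_bigr => x /(h'E f); rewrite /upd' => ->.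
have int_upd f : measurable_fun setT f -> L1 (f \o xi y) ->
    forall x, measurable_fun setT (upd' f x) /\ L1 (upd' f x \o xi x).
  by move=> mf If x; rewrite /upd'; case: eqP => [->|].
have step f : measurable_fun setT f -> L1 (f \o xi y) -> (forall t, 0 <= f t) ->
    L1 (fun w => f (xi y w) * \prod_(x <- s1 ++ s2) h x (xi x w)) /\
    \int[P]_w (f (xi y w) * \prod_(x <- s1 ++ s2) h x (xi x w)) =
    (\int[P]_w f (xi y w)) * \prod_(x <- s1 ++ s2) \int[P]_w (h x (xi x w)).
  move=> mf If f0; have iu := int_upd f mf If; split.
    rewrite -(_ : (fun w => \prod_(x <- y :: s1 ++ s2) upd' f x (xi x w)) =
      (fun w => f (xi y w) * \prod_(x <- s1 ++ s2) h x (xi x w))); last first.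
      by apply/funext => w; exact: prodE.
    by apply: iid_integrable_prod; rewrite /= ?ys// => x; have [] := iu x.
  have := ih (y :: s2) (upd' f) us' (fun x => (iu x).1) (fun x => (iu x).2).
  rewrite (perm_big _ perm) big_cons /=.
  have -> : \prod_(j <- s1 ++ s2) \int[P]_w upd' f j (xi j w) =
     \prod_(x <- s1 ++ s2) \int[P]_w (h x (xi x w)).
    by rewrite big_seq [RHS]big_seq; apply: eq_bigr => x /(h'E f) ->.
  have yE : upd' f y = f by rewrite /upd' eqxx.
  rewrite yE => <-.
    apply: eq_Rintegral => w _; rewrite (perm_big _ perm)/= prodE//.
  move=> x; rewrite inE /upd'; case: eqP => [_ _|_ /= xs]; first exact: f0.
  exact: h0.
pose p t := Num.max (h y t) 0; pose n t := Num.max (- h y t) 0.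
have hpn t : h y t = p t - n t by rewrite /p /n; case: (leP (h y t) 0); case: (leP (- h y t) 0); lra.
have p0 t : 0 <= p t by rewrite le_max lexx orbT.
have n0 t : 0 <= n t by rewrite le_max lexx orbT.
have mp : measurable_fun setT p by apply: measurable_maxr.
have mn : measurable_fun setT n by apply: measurable_maxr => //; apply: measurableT_comp.
have Ip : L1 (p \o xi y).
  apply: le_integrable (ih1 y) => //; first by apply/measurable_EFinP; exact: measurableT_comp.
  move=> w _; rewrite lee_fin /= ger0_norm// /p ge_max normr_ge0 ler_norm//.
have In : L1 (n \o xi y).
  apply: le_integrable (ih1 y) => //; first by apply/measurable_EFinP; exact: measurableT_comp.
  move=> w _; rewrite lee_fin /= ger0_norm// /n ge_max normr_ge0 -normrN ler_norm//.
have [Ipp Ep] := step p mp Ip p0.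
have [Inn En] := step n mn In n0.
rewrite big_cons.
under eq_Rintegral do rewrite big_cons hpn mulrBl.
rewrite RintegralB// Ep En -mulrBl; congr (_ * _).
by rewrite -RintegralB//; apply: eq_Rintegral => w _; rewrite /= -hpn.
Qed.

Lemma iid_Rintegral_prod (s : seq (site d)) (h : site d -> R -> R) :
  uniq s -> (forall x, measurable_fun setT (h x)) ->
  (forall x, L1 (h x \o xi x)) ->
  \int[P]_w (\prod_(x <- s) h x (xi x w)) =
  \prod_(x <- s) \int[P]_w (h x (xi x w)).
Proof.
move=> us mh ih; have := @iid_Rintegral_prod_cat s [::] h.
by rewrite cats0; apply.
Qed.

Lemma iid_integral_ident (h : R -> \bar R) x : measurable_fun setT h ->
  (forall t, 0 <= h t)%E ->
  (\int[P]_w h (xi x w) = \int[P]_w h (xi (origin d) w))%E.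
Proof.
move=> mh h0.
have := @ge0_integral_pushforward _ _ _ _ R _ (mxi x) P setT h measurableT mh (fun t _ => h0 t).
have := @ge0_integral_pushforward _ _ _ _ R _ (mxi (origin d)) P setT h measurableT mh (fun t _ => h0 t).
rewrite !preimage_setT /= => <- <-.
apply: eq_measure_integral => B mB _; rewrite /pushforward.
by case: xi_iid => _ + _; apply.
Qed.

End expectation.

Section moments.
Variables (R : realType) (dO : measure_display) (Omega : measurableType dO)
  (P : probability Omega R).

Local Notation L1 f := (P.-integrable setT (EFin \o f)).

Lemma integrable_Rsum (I : Type) (s : seq I) (f : I -> Omega -> R) :
  (forall i, L1 (f i)) -> L1 (fun w => \sum_(i <- s) f i w).
Proof.
move=> If; have := @integrable_sum _ _ R P setT measurableT I s xpredT (fun i => EFin \o f i) (fun i _ => If i).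
by congr (integrable _ _ _); apply/funext => w /=; rewrite sumEFin.
Qed.

Lemma Rintegral_sum (I : Type) (s : seq I) (f : I -> Omega -> R) :
  (forall i, L1 (f i)) ->
  \int[P]_w (\sum_(i <- s) f i w) = \sum_(i <- s) \int[P]_w (f i w).
Proof.
move=> If; elim: s => [|i s ih].
  by under eq_Rintegral do rewrite big_nil; rewrite big_nil Rintegral_cst// mul0r.
under eq_Rintegral do rewrite big_cons.
rewrite big_cons RintegralD//; last exact: integrable_Rsum.
by rewrite ih.
Qed.

Lemma sqr_sum (I : Type) (s : seq I) (a : I -> R) :
  (\sum_(i <- s) a i) ^+ 2 = \sum_(i <- s) \sum_(j <- s) a i * a j.
Proof. by rewrite expr2 mulr_suml; apply: eq_bigr => i _; rewrite mulr_sumr. Qed.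

Lemma integrable_sqr_sum (I : Type) (s : seq I) (f : I -> Omega -> R) :
  (forall i j, L1 (fun w => f i w * f j w)) ->
  L1 (fun w => (\sum_(i <- s) f i w) ^+ 2).
Proof.
move=> If; rewrite (_ : (fun w => _) = fun w => \sum_(i <- s) \sum_(j <- s) f i w * f j w).
  by apply: integrable_Rsum => i; apply: integrable_Rsum.
by apply/funext => w; rewrite sqr_sum.
Qed.

Lemma Rintegral_sqr_sum (I : Type) (s : seq I) (f : I -> Omega -> R) :
  (forall i j, L1 (fun w => f i w * f j w)) ->
  \int[P]_w (\sum_(i <- s) f i w) ^+ 2 =
  \sum_(i <- s) \sum_(j <- s) \int[P]_w (f i w * f j w).
Proof.
move=> If; under eq_Rintegral do rewrite sqr_sum.
rewrite Rintegral_sum; last by move=> i; apply: integrable_Rsum.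
by apply: eq_bigr => i _; rewrite Rintegral_sum.
Qed.

(** Every probabilistic estimate below takes this form, so that a union bound over a few exceptional
    sets makes all of them hold for the same realisation. *)
Lemma markov_set (f : Omega -> R) (b delta : R) :
  L1 f -> (forall w, 0 <= f w) -> 0 < b -> 0 < delta -> \int[P]_w f w <= b ->
  exists2 S : set Omega, measurable S /\ (P S <= delta%:E)%E &
    forall w, ~ S w -> f w < b / delta.
Proof.
move=> If f0 b0 d0 fb.
have mf : measurable_fun setT f by move/measurable_int: If => /measurable_EFinP.
exists [set w | b / delta <= f w].
  have mS : measurable [set w | b / delta <= f w].
    rewrite (_ : [set w | _] = setT `&` f @^-1` `[b / delta, +oo[%classic).
      exact: mf.
    by apply/seteqP; split => w /=; rewrite in_itv/= andbT; [|case].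
  split=> //.
  have bd0 : 0 < b / delta by exact: divr_gt0.
  have := @le_integral_abse _ _ R P setT measurableT (EFin \o f) (b / delta)
    (measurable_int P If) bd0.
  rewrite setTI; under eq_integral do rewrite /= ger0_norm//.
  have -> : [set x | (`|(EFin \o f) x| >= (b / delta)%:E)%E] = [set w | b / delta <= f w].
    by apply/seteqP; split => w /=; rewrite lee_fin ger0_norm.
  have -> : (\int[P]_x (f x)%:E = (\int[P]_w f w)%:E)%E.
    by rewrite /Rintegral fineK//; exact: integrable_fin_num.
  move=> h; have {h} := le_trans h (_ : (_ <= b%:E)%E).
  rewrite lee_fin => /(_ fb) h.
  rewrite -(@lee_pmul2l _ (b / delta)%:E)//; apply: le_trans h _.
  by rewrite -EFinM lee_fin divfK// gt_eqF.
by move=> w /= /negP; rewrite -ltNge.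
Qed.

Variables (d : nat) (xi : site d -> Omega -> R).
Hypothesis xi_iid : iid_field P xi.
Hypothesis sq_fin : (\int[P]_w ((xi (origin d) w) ^+ 2)%:E < +oo)%E.

Let mxi x : measurable_fun setT (xi x). Proof. by case: xi_iid. Qed.

Lemma iid_integrable (f : R -> R) x : measurable_fun setT f ->
  L1 (f \o xi (origin d)) -> L1 (f \o xi x).
Proof.
move=> mf /integrableP[_ If]; apply/integrableP; split.
  by apply/measurable_EFinP; exact: measurableT_comp.
rewrite (iid_integral_ident xi_iid (h := fun t => `|(f t)%:E|%E))//.
by apply: measurableT_comp => //; exact/measurable_EFinP.
Qed.

Lemma iid_Rintegral (f : R -> R) x : measurable_fun setT f ->
  L1 (f \o xi (origin d)) -> \int[P]_w f (xi x w) = \int[P]_w f (xi (origin d) w).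
Proof.
move=> mf If; have Ix := iid_integrable x mf If.
congr fine.
have mf' : measurable_fun setT (EFin \o f) by exact/measurable_EFinP.
have h y : L1 (f \o xi y) -> (\int[pushforward P (xi y)]_t (f t)%:E = \int[P]_w (f (xi y w))%:E)%E.
  by move=> Iy; rewrite (@integral_pushforward _ _ _ _ R _ (mxi y) P setT (EFin \o f)).
rewrite -!h//; apply: eq_measure_integral => B mB _.
by case: xi_iid => _ + _; apply.
Qed.

Lemma iid_Rintegral2 (f g : R -> R) x y : x != y ->
  measurable_fun setT f -> measurable_fun setT g ->
  L1 (f \o xi (origin d)) -> L1 (g \o xi (origin d)) ->
  L1 (fun w => f (xi x w) * g (xi y w)) /\
  \int[P]_w (f (xi x w) * g (xi y w)) =
  (\int[P]_w f (xi (origin d) w)) * (\int[P]_w g (xi (origin d) w)).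
Proof.
move=> xy mf mg If Ig; pose h z := if z == x then f else g.
have yx : (y == x) = false by rewrite eq_sym (negbTE xy).
have mh z : measurable_fun setT (h z) by rewrite /h; case: ifP.
have Ih z : L1 (h z \o xi z) by rewrite /h; case: ifP => _; exact: iid_integrable.
have us : uniq [:: x; y] by rewrite /= inE xy.
have hE w : \prod_(z <- [:: x; y]) h z (xi z w) = f (xi x w) * g (xi y w).
  by rewrite !big_cons big_nil mulr1 /h eqxx yx.
split.
  by have := iid_integrable_prod xi_iid us mh Ih; under eq_fun do rewrite hE.
have := iid_Rintegral_prod xi_iid us mh Ih.
under eq_Rintegral do rewrite hE.
move=> ->; rewrite !big_cons big_nil mulr1 /h eqxx yx.
by rewrite !iid_Rintegral.
Qed.

Let sqr_integrable : L1 (fun w => xi (origin d) w ^+ 2).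
Proof.
have mx2 : measurable_fun setT (fun w => xi (origin d) w ^+ 2).
  by apply: measurable_funX; exact: mxi.
apply/(ge0_integrableP P mx2); first by move=> w; exact: sqr_ge0.
by rewrite ge0_fin_numE// integral_ge0// => w _; rewrite lee_fin sqr_ge0.
Qed.

Lemma quadratic_integrable (K : R) (f : R -> R) x : measurable_fun setT f ->
  (forall t, `|f t| <= K * (1 + t ^+ 2)) -> L1 (f \o xi x).
Proof.
move=> mf fb; apply: iid_integrable => //.
apply: (@integrableW _ _ _ _ _ (fun w => K * (1 + xi (origin d) w ^+ 2))).
- exact: measurableT_comp.
- by move=> w; exact: fb.
- have := integrableZl measurableT K (integrableD measurableT (finite_measure_integrable_cst P 1 measurableT) sqr_integrable).
  by congr (integrable _ _ _).
Qed.

(** Since [f] is centred, independence kills every term with two distinct sites. The quadratic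
    growth bound secures integrability. *)
Lemma variance_sum (K : R) (f : R -> R) (s : seq (site d)) (c : site d -> R) :
  measurable_fun setT f -> (forall t, (f t) ^+ 2 <= K * (1 + t ^+ 2)) ->
  \int[P]_w f (xi (origin d) w) = 0 -> uniq s ->
  L1 (fun w => (\sum_(x <- s) c x * f (xi x w)) ^+ 2) /\
  \int[P]_w (\sum_(x <- s) c x * f (xi x w)) ^+ 2 =
    (\sum_(x <- s) c x ^+ 2) * \int[P]_w (f (xi (origin d) w)) ^+ 2.
Proof.
move=> mf fb f0 us.
have mf2 : measurable_fun setT (fun t => f t ^+ 2) by exact: measurable_funX.
have If2 x : L1 (fun w => f (xi x w) ^+ 2).
  apply: (@quadratic_integrable K (fun t => f t ^+ 2)) => // t.
  by rewrite ger0_norm ?sqr_ge0.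
have If x : L1 (fun w => f (xi x w)).
  apply: (@quadratic_integrable (K + 1) f) => // t.
  have h0 : `|f t| <= 1 + f t ^+ 2.
    have := sqr_ge0 (`|f t| - 1); rewrite -(real_normK (num_real (f t))).
    have := normr_ge0 (f t); nra.
  apply: le_trans h0 _; have := fb t; have := sqr_ge0 t; lra.
have E2 x y : L1 (fun w => f (xi x w) * f (xi y w)) /\
    \int[P]_w (f (xi x w) * f (xi y w)) =
    (x == y)%:R * \int[P]_w (f (xi (origin d) w)) ^+ 2.
  have [<-|xy] := eqVneq x y.
    rewrite mul1r; split; first exact: If2.
    rewrite -(@iid_Rintegral (fun t => f t ^+ 2) x)//; exact: If2.
  have [I ->] := iid_Rintegral2 xy mf mf (If _) (If _).
  by rewrite f0 !mul0r.
have Icc x y : L1 (fun w => c x * f (xi x w) * (c y * f (xi y w))).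
  have := integrableZl measurableT (c x * c y) (E2 x y).1.
  by congr (integrable _ _ _); apply/funext => w /=; rewrite -EFinM mulrACA.
split; first exact: integrable_sqr_sum.
rewrite Rintegral_sqr_sum// mulr_suml big_seq [RHS]big_seq.
apply: eq_bigr => x xs; rewrite (bigD1_seq x)//= big1 ?addr0.
  under eq_Rintegral do rewrite mulrACA -expr2.
  rewrite RintegralZl//; last exact: (E2 x x).1.
  by rewrite (E2 x x).2 eqxx mul1r.
move=> y yx; under eq_Rintegral do rewrite mulrACA.
rewrite RintegralZl//; last exact: (E2 x y).1.
by rewrite (E2 x y).2 eq_sym (negbTE yx) mul0r mulr0.
Qed.

Lemma prod_if_pred1 (s : seq (site d)) a (F : site d -> R) : uniq s -> a \in s ->
  \prod_(z <- s) (if z == a then F z else 1) = F a.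
Proof.
move=> us sa; rewrite (bigD1_seq a)//= eqxx big1 ?mulr1// => z /negbTE -> //.
Qed.

Section off_diagonal.
Variable b : R -> R.
Hypotheses (mb : measurable_fun setT b) (b1 : forall t, `|b t| <= 1).
Hypotheses (m0 : \int[P]_w xi (origin d) w = 0)
  (b0 : \int[P]_w b (xi (origin d) w) = 0).

Let v := \int[P]_w xi (origin d) w ^+ 2.

(** Unless [p] and [q] have the same two sites, some site occurs only once and contributes a centred
    factor. Otherwise [|b| <= 1] removes the factors [b], and a second moment of [xi] remains. *)
Lemma four_point (p q : site d * site d) : p.1 != p.2 -> q.1 != q.2 ->
  let Z (p : site d * site d) w := xi p.1 w * b (xi p.2 w) in
  L1 (fun w => Z p w * Z q w) /\
  \int[P]_w (Z p w * Z q w) <= v * ((q == p)%:R + (q == (p.2, p.1))%:R).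
Proof.
move=> p12 q12 Z.
have absb x y w : `|xi x w * b (xi y w)| <= `|xi x w|.
  by rewrite normrM ler_piMr.
have bound w : `|Z p w * Z q w| <= 2^-1 * (xi p.1 w ^+ 2 + xi q.1 w ^+ 2).
  rewrite normrM; have h1 := absb p.1 p.2 w; have h2 := absb q.1 q.2 w.
  have h : `|Z p w| * `|Z q w| <= `|xi p.1 w| * `|xi q.1 w| by exact: ler_pM.
  apply: le_trans h _; rewrite -(real_normK (num_real (xi p.1 w))) -(real_normK (num_real (xi q.1 w))).
  by have := sqr_ge0 (`|xi p.1 w| - `|xi q.1 w|); nra.
have I2 x : L1 (fun w => xi x w ^+ 2).
  by apply: (@iid_integrable (fun t => t ^+ 2)) => //; exact: measurable_funX.
have Ib : L1 (fun w => 2^-1 * (xi p.1 w ^+ 2 + xi q.1 w ^+ 2)).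
  have := integrableZl measurableT (2^-1) (integrableD measurableT (I2 p.1) (I2 q.1)).
  by congr (integrable _ _ _).
have mZ r : measurable_fun setT (Z r).
  by apply: measurable_funM; [exact: mxi|exact: measurableT_comp].
have IZ : L1 (fun w => Z p w * Z q w).
  by apply: (integrableW _ bound Ib); exact: measurable_funM.
split=> //.
have Ev x : \int[P]_w xi x w ^+ 2 = v.
  by rewrite (@iid_Rintegral (fun t => t ^+ 2) x).
have v0 : 0 <= v by apply: Rintegral_ge0 => w _; exact: sqr_ge0.
have le_v : \int[P]_w (Z p w * Z q w) <= v.
  apply: (@le_trans _ _ (\int[P]_w (2^-1 * (xi p.1 w ^+ 2 + xi q.1 w ^+ 2)))).
    by apply: le_Rintegral => // w _; apply: le_trans (ler_norm _) (bound w).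
  rewrite RintegralZl//; last first.
    by have := integrableD measurableT (I2 p.1) (I2 q.1); congr (integrable _ _ _).
  by rewrite RintegralD// !Ev; lra.
have [_|qp] := eqVneq q p.
  apply: (le_trans le_v).
  by rewrite mulrDr mulr1 lerDl mulr_ge0.
have [_|qp'] := eqVneq q (p.2, p.1).
  by rewrite add0r mulr1.
rewrite addr0 mulr0.
(* All factors at the site [z] are collected in [h z], so that every pattern of coincidences among
   the four sites becomes one product over distinct sites. *)
pose h z t : R := (if z == p.1 then t else 1) * (if z == p.2 then b t else 1) *
   ((if z == q.1 then t else 1) * (if z == q.2 then b t else 1)).
pose s := undup [:: p.1; p.2; q.1; q.2].
have us : uniq s by exact: undup_uniq.
have hE w : \prod_(z <- s) h z (xi z w) = Z p w * Z q w.
  rewrite /h !big_split/= (prod_if_pred1 (a := p.1) (fun z => xi z w))//; last by rewrite mem_undup !inE eqxx.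
  rewrite (prod_if_pred1 (a := p.2) (fun z => b (xi z w)))//; last by rewrite mem_undup !inE eqxx orbT.
  rewrite (prod_if_pred1 (a := q.1) (fun z => xi z w))//; last by rewrite mem_undup !inE eqxx !orbT.
  by rewrite (prod_if_pred1 (a := q.2) (fun z => b (xi z w)))//; last by rewrite mem_undup !inE eqxx !orbT.
have mif (B : bool) (f : R -> R) : measurable_fun setT f -> measurable_fun setT (fun t => if B then f t else 1).
  by case: B.
have mh z : measurable_fun setT (h z).
  by do 2 (apply: measurable_funM); apply: mif.
have Ih z : L1 (h z \o xi z).
  apply: (@quadratic_integrable 1) => // t; rewrite mul1r /h !normrM.
  have bb (B : bool) : `|if B then b t else 1| <= 1 by case: B; rewrite ?normr1.
  have tt (B : bool) : `|if B then t else 1| ^+ 2 <= 1 + t ^+ 2.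
    by rewrite real_normK ?num_real//; case: B; rewrite ?expr1n ?lerDl ?lerDr ?sqr_ge0.
  have := bb (z == p.2); have := bb (z == q.2); have := tt (z == p.1); have := tt (z == q.1).
  set x1 := `|if z == p.1 then t else 1|; set x2 := `|if z == p.2 then b t else 1|.
  set x3 := `|if z == q.1 then t else 1|; set x4 := `|if z == q.2 then b t else 1|.
  have g1 : 0 <= x1 by exact: normr_ge0.
  have g2 : 0 <= x2 by exact: normr_ge0.
  have g3 : 0 <= x3 by exact: normr_ge0.
  have g4 : 0 <= x4 by exact: normr_ge0.
  move=> h1 h2 h3 h4.
  have k1 : x1 * x2 * (x3 * x4) <= x1 * x3.
    by rewrite mulrACA ler_piMr ?mulr_ge0// mulr_ile1.
  apply: le_trans k1 _; have := sqr_ge0 (x1 - x3); rewrite sqrrB; lra.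
under eq_Rintegral do rewrite -hE.
rewrite (iid_Rintegral_prod xi_iid)//.
suff [z zs z0] : exists2 z, z \in s & \int[P]_w h z (xi z w) = 0.
  by rewrite (bigD1_seq z)//= z0 mul0r.
have xi0 x : \int[P]_w xi x w = 0.
  rewrite (@iid_Rintegral (fun t => t) x)//; apply: (@quadratic_integrable 1) => // t.
  rewrite mul1r -(real_normK (num_real t)); have := sqr_ge0 (`|t| - 1); have := normr_ge0 t; nra.
have bxi0 x : \int[P]_w b (xi x w) = 0.
  rewrite (@iid_Rintegral b x)//; apply: (@quadratic_integrable 1) => // t.
  by rewrite mul1r; apply: le_trans (b1 t) _; rewrite lerDl sqr_ge0.
(* Either [p.1] is absent from [q], or it is present and then [p.2] is absent, because [q] is
   neither [p] nor its swap. *)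
have [p1q|p1q] := boolP (p.1 \in [:: q.1; q.2]); last first.
  exists p.1; first by rewrite mem_undup !inE eqxx.
  rewrite !inE negb_or in p1q; case/andP: p1q => /negbTE e1 /negbTE e2.
  rewrite -[RHS](xi0 p.1); apply: eq_Rintegral => w _.
  by rewrite /h eqxx (negbTE p12) e1 e2 !mulr1.
exists p.2; first by rewrite mem_undup !inE eqxx orbT.
have [e1 e2] : p.2 != q.1 /\ p.2 != q.2.
  have key (x y z t : site d) : x != y -> (z, t) != (x, y) -> (z, t) != (y, x) ->
      x \in [:: z; t] -> y != z /\ y != t.
    move=> xy h1 h2; rewrite !inE => /orP[] /eqP E.
      move: h1 xy; rewrite E xpair_eqE eqxx /= => h1 xy.
      by rewrite eq_sym xy eq_sym h1.
    move: h2 xy; rewrite E xpair_eqE eqxx andbT /= => h2 xy.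
    by rewrite eq_sym h2 eq_sym xy.
  by apply: (key p.1) => //; rewrite -!surjective_pairing.
rewrite -[RHS](bxi0 p.2); apply: eq_Rintegral => w _.
by rewrite /h eqxx eq_sym (negbTE p12) (negbTE e1) (negbTE e2) !mulr1 mul1r.
Qed.

(** In the expanded square each pair [p] meets at most two partners, itself and its swap; one of the
    two weights is bounded by [F]. *)
Lemma off_diagonal_sqr (L : seq (site d * site d)) (c : site d * site d -> R) (F : R) :
  uniq L -> (forall p, p \in L -> p.1 != p.2) -> (forall p, 0 <= c p <= F) ->
  L1 (fun w => (\sum_(p <- L) c p * (xi p.1 w * b (xi p.2 w))) ^+ 2) /\
  \int[P]_w (\sum_(p <- L) c p * (xi p.1 w * b (xi p.2 w))) ^+ 2 <=
   2 * v * F * \sum_(p <- L) c p.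
Proof.
move=> uL L12 cF.
have v0 : 0 <= v by apply: Rintegral_ge0 => w _; exact: sqr_ge0.
(* The general lemmas ask for integrability at every index, while [four_point] covers off-diagonal
   pairs only; the value 0 off [L] bridges this. *)
pose f p w := if p \in L then c p * (xi p.1 w * b (xi p.2 w)) else 0.
have fE w : \sum_(p <- L) c p * (xi p.1 w * b (xi p.2 w)) = \sum_(p <- L) f p w.
  by rewrite big_seq [RHS]big_seq; apply: eq_bigr => p pL; rewrite /f pL.
have If p q : L1 (fun w => f p w * f q w).
  rewrite /f; have [pL|_] := boolP (p \in L); last first.
    by under eq_fun do rewrite mul0r; exact: finite_measure_integrable_cst.
  have [qL|_] := boolP (q \in L); last first.
    by under eq_fun do rewrite mulr0; exact: finite_measure_integrable_cst.
  have := integrableZl measurableT (c p * c q) (four_point (L12 p pL) (L12 q qL)).1.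
  by congr (integrable _ _ _); apply/funext => w /=; rewrite -EFinM mulrACA.
have Ef p q : p \in L -> q \in L -> \int[P]_w (f p w * f q w) <=
    c p * c q * (v * ((q == p)%:R + (q == (p.2, p.1))%:R)).
  move=> pL qL; rewrite /f pL qL; under eq_Rintegral do rewrite mulrACA.
  have [I4 E4] := four_point (L12 p pL) (L12 q qL).
  rewrite RintegralZl//; apply: ler_wpM2l => //.
  by rewrite mulr_ge0//; [have /andP[] := cF p|have /andP[] := cF q].
split.
  under eq_fun do rewrite fE.
  exact: integrable_sqr_sum.
under eq_Rintegral do rewrite fE.
rewrite Rintegral_sqr_sum// mulr_sumr big_seq [leRHS]big_seq.
apply: ler_sum => p pL.
apply: (@le_trans _ _ (\sum_(q <- L) c p * (F * v) * ((q == p)%:R + (q == (p.2, p.1))%:R))).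
  rewrite big_seq [leRHS]big_seq; apply: ler_sum => q qL.
  apply: le_trans (Ef p q pL qL) _.
  have /andP[cp0 _] := cF p; have /andP[cq0 cqF] := cF q.
  rewrite -!mulrA ler_wpM2l//; apply: ler_pM => //.
  by rewrite mulr_ge0// addr_ge0.
rewrite -mulr_sumr big_split/=.
have cnt r : \sum_(q <- L) (q == r)%:R <= 1 :> R.
  have [rL|rL] := boolP (r \in L).
    by rewrite (bigD1_seq r)//= eqxx big1 ?addr0// => q /negbTE ->.
  by rewrite big_seq big1// => q qL; case: eqP => // qr; rewrite -qr qL in rL.
have /andP[cp0 cpF] := cF p; have F0 := le_trans cp0 cpF.
have := lerD (cnt p) (cnt (p.2, p.1)) => /(ler_wpM2l (mulr_ge0 cp0 (mulr_ge0 F0 v0))).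
move=> /le_trans; apply; lra.
Qed.
End off_diagonal.
End moments.

(** * Truncated Green function *)

Section kernel.
Variables (R : realType) (d : nat).
Implicit Types x y : site d.

Definition linf x : nat := \max_(i < d) `|x i|%N.

Lemma linf_inbox N x : (linf x <= N)%N = inbox N x.
Proof.
apply/bigmax_leqP/forallP => H i; first by have := H i isT; lia.
by move=> _; have := H i; lia.
Qed.

Lemma linf_nbrs x y : y \in nbrs x -> (linf y <= (linf x).+1)%N.
Proof.
by move=> yx; rewrite linf_inbox; apply: inbox_nbrs yx; rewrite -linf_inbox.
Qed.

Lemma box_shell N (w : nat -> R) :
  \sum_(x <- box d N.+1) w (linf x) =
  \sum_(x <- box d N) w (linf x) + ((N.+1.*2.+1 ^ d)%:R - (N.*2.+1 ^ d)%:R) * w N.+1.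
Proof.
rewrite (bigID (inbox N))/=.
have perm : perm_eq (seq.filter (inbox N) (box d N.+1)) (box d N).
  apply: uniq_perm; rewrite ?filter_uniq ?uniq_box// => x.
  rewrite mem_filter !mem_box; case: (boolP (inbox N x)) => //= xN.
  by rewrite (inboxW _ xN).
rewrite -big_filter (perm_big _ perm)/=; congr (_ + _).
have -> : \sum_(x <- box d N.+1 | ~~ inbox N x) w (linf x) =
    \sum_(x <- box d N.+1 | ~~ inbox N x) w N.+1.
  rewrite big_seq_cond [RHS]big_seq_cond; apply: eq_bigr => x /andP[].
  rewrite mem_box -!linf_inbox -ltnNge => h1 h2; congr w; lia.
rewrite big_const_seq iter_addr_0 -[LHS]mulr_natl; congr (_ * _).
have := count_predC (inbox N) (box d N.+1).
rewrite -size_filter (perm_size perm) !size_box => <-.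
by rewrite natrD addrAC subrr add0r.
Qed.

(** Radial slope of the kernel, inverse to the order of the number of sites at distance [k + 1]: the
    flux through every sphere is then of order one, as for a Green function. The kernel is a tent
    for [d = 1] and a truncated logarithm for [d = 2]; its value at the origin is [kernel_sum]. *)
Definition kernel_coef (k : nat) : R := (k.+1%:R ^+ d.-1)^-1.
Definition kernel_sum (L : nat) : R := \sum_(k < L) kernel_coef k.
Definition kernel_fun (L : nat) x : R := \sum_(linf x <= k < L) kernel_coef k.

Lemma kernel_coef_ge0 k : 0 <= kernel_coef k.
Proof. by rewrite invr_ge0 exprn_ge0. Qed.

Lemma kernel_fun_ge0 L x : 0 <= kernel_fun L x.
Proof. by apply: sumr_ge0 => k _; exact: kernel_coef_ge0. Qed.

Lemma kernel_fun_le L x : kernel_fun L x <= kernel_sum L.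
Proof.
rewrite /kernel_sum -(big_mkord xpredT kernel_coef).
have [xL|xL] := leqP (linf x) L.
  rewrite (big_cat_nat (n := linf x))//=. rewrite lerDr.
  by apply: sumr_ge0 => k _; exact: kernel_coef_ge0.
have -> : kernel_fun L x = 0 by rewrite /kernel_fun big_geq// ltnW.
by apply: sumr_ge0 => k _; exact: kernel_coef_ge0.
Qed.

Lemma kernel_fun0 L : kernel_fun L (origin d) = kernel_sum L.
Proof.
rewrite /kernel_fun (_ : linf _ = 0%N) ?big_mkord//.
by apply/eqP; rewrite -leqn0 linf_inbox; apply/forallP => i; rewrite ffunE.
Qed.

Lemma kernel_fun_out L x : ~~ inbox L x -> kernel_fun L x = 0.
Proof. by rewrite -linf_inbox -ltnNge => xL; rewrite /kernel_fun big_geq// ltnW. Qed.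

Lemma kernel_sum_ge1 L : (0 < L)%N -> 1 <= kernel_sum L.
Proof.
case: L => // L _; rewrite /kernel_sum big_ord_recl {1}/kernel_coef expr1n invr1 lerDl.
by apply: sumr_ge0 => k _; exact: kernel_coef_ge0.
Qed.

(** Sup-norms of neighbours differ by at most one, so the difference is at most one coefficient. An
    inward step gives the index [linf x - 1], an outward one [linf x]; the coefficients decrease,
    hence the predecessor covers both. *)
Lemma kernel_fun_edge L x y : y \in nbrs x ->
  (kernel_fun L x - kernel_fun L y) ^+ 2 <=
  (if (linf x <= L)%N then kernel_coef (linf x).-1 else 0) ^+ 2.
Proof.
move=> yx; have h1 := linf_nbrs yx; have h2 := linf_nbrs (nbrs_sym yx).
rewrite /kernel_fun; move: (linf x) (linf y) h1 h2 => r s h1 h2.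
have mono k : kernel_coef k.+1 <= kernel_coef k.
  rewrite lef_pV2 ?posrE ?exprn_gt0//; apply: lerXn2r; rewrite ?nnegrE//.
  by rewrite ler_nat.
have [->|sr] := eqVneq s r; first by rewrite subrr expr0n/= sqr_ge0.
have [sr1|sr1] := ltnP s r.
  have -> : r = s.+1 by lia.
  have [sL|sL] := ltnP s L; last by rewrite !big_geq ?subrr ?expr0n//=; lia.
  by rewrite [X in _ - X]big_ltn//= opprD addrCA subrr addr0 sqrrN.
have -> : s = r.+1 by lia.
have [rL|rL] := ltnP r L; last by rewrite !big_geq ?subrr ?expr0n/= ?sqr_ge0//; lia.
rewrite big_ltn// addrK ltnW// lerXn2r ?nnegrE ?kernel_coef_ge0//.
by case: (r) => //= r'.
Qed.

(** The shell of radius [k + 1] has at most [8 (k+1)^(d-1)] sites, so with squared slopes it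
    contributes at most [8 * kernel_coef k]. The origin adds 1; with [kernel_sum L >= 1] the sum is
    at most [9 * kernel_sum L], and at most four neighbours per site give 36. The bound is uniform
    in [M]. *)
Lemma kernel_energy L M : (0 < d <= 2)%N -> (0 < L)%N ->
  energy M (kernel_fun L) <= 36 * kernel_sum L.
Proof.
move=> d12 L0.
pose w r : R := (if (r <= L)%N then kernel_coef r.-1 else 0) ^+ 2.
have w0 r : 0 <= w r by exact: sqr_ge0.
have h1 : energy M (kernel_fun L) <= \sum_(x <- box d M) 4 * w (linf x).
  rewrite /energy; apply: ler_sum => x _.
  apply: (@le_trans _ _ (\sum_(y <- nbrs x) w (linf x))).
    by rewrite big_seq [leRHS]big_seq; apply: ler_sum => y; exact: kernel_fun_edge.
  rewrite big_const_seq count_predT iter_addr_0 size_nbrs -[_ *+ _]mulr_natl.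
  by rewrite ler_wpM2r// (ler_nat _ _ 4); lia.
apply: le_trans h1 _; rewrite -mulr_sumr.
suff h2 : \sum_(x <- box d M) w (linf x) <= 1 + 8 * kernel_sum (minn M L).
  have h3 : kernel_sum (minn M L) <= kernel_sum L.
    rewrite /kernel_sum -!(big_mkord xpredT kernel_coef).
    rewrite (big_cat_nat (n := minn M L) (p := L))//=; last exact: geq_minr.
    by rewrite lerDl sumr_ge0// => k _; exact: kernel_coef_ge0.
  have := kernel_sum_ge1 L0; lra.
elim: M => [|M ih].
  have -> : box d 0 = [:: origin d].
    apply: perm_small_eq => //; apply: uniq_perm; rewrite ?uniq_box// => x.
    rewrite mem_box inE; apply/forallP/eqP => [H|-> i]; last by rewrite ffunE.
    apply/ffunP => i; rewrite ffunE; move: (H i); rewrite oppr0 => h; apply/le_anti.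
    by rewrite andbC.
  rewrite big_seq1 min0n /kernel_sum big_ord0 mulr0 addr0 /w.
  have -> : linf (origin d) = 0%N.
    by apply/eqP; rewrite -leqn0 linf_inbox; apply/forallP => i; rewrite ffunE.
  by rewrite /= /kernel_coef expr1n invr1 expr1n.
rewrite box_shell; have [ML|ML] := ltnP M L; last first.
  rewrite /w leqNgt ltnS ML /= expr0n /= mulr0 addr0.
  by move: ih; rewrite !(minn_idPr _)// ltnW.
rewrite (minn_idPl _)// /kernel_sum big_ord_recr/= mulrDr addrA.
move: ih; rewrite (minn_idPl (ltnW ML)) => /lerD; apply.
rewrite /w ML /=.
have -> : 8 * kernel_coef M = (8 * M.+1%:R ^+ d.-1) * kernel_coef M ^+ 2.
  rewrite /kernel_coef expr2 mulrA -mulrA -[in RHS]mulrA; congr (_ * _).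
  by rewrite mulrA divff ?mul1r// expf_neq0// pnatr_eq0.
rewrite ler_wpM2r ?sqr_ge0// -natrX -natrM -natrB ?leq_exp2r//; [|lia|lia].
rewrite ler_nat.
move: d12 => /andP[]; case: (d) => [|[|[|]]] //= _ _; rewrite ?expn1 ?expn0 ?expnS ?expn0; nia.
Qed.

(** For [d <= 2] the coefficients dominate the harmonic series. *)
Lemma kernel_sum_unbounded (M : R) : (0 < d <= 2)%N ->
  exists2 L, (0 < L)%N & M <= kernel_sum L.
Proof.
move=> d12; apply: contrapT => H.
have lt_M L : (0 < L)%N -> kernel_sum L < M.
  by move=> L0; rewrite ltNge; apply/negP => h; apply: H; exists L.
have harm k : k.+1%:R^-1 <= kernel_coef k.
  rewrite lef_pV2 ?posrE ?exprn_gt0//.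
  move: d12 => /andP[]; case: (d) => [|[|[|]]] //= _ _.
  by rewrite ?expr0 ler1n.
apply: (@dvg_harmonic R); apply: nondecreasing_is_cvgn.
  move=> m n mn; rewrite /series/= [leRHS](big_cat_nat (n := m))//= lerDl.
  by apply: sumr_ge0 => k _; rewrite invr_ge0.
exists (Num.max M 0) => _ [n _ <-]; rewrite /series /=.
case: n => [|n]; first by rewrite big_geq// le_max lexx orbT.
rewrite le_max; apply/orP; left; apply: le_trans (ltW (lt_M n.+1 isT)).
by rewrite /kernel_sum big_mkord; apply: ler_sum => k _; exact: harm.
Qed.

(* In dimension one the noise of the tilt has size [N^(3/2)], which forces
   [L] of order [sqrt N]; in dimension two a large fixed [L] suffices. *)
Lemma kernel_scales (M rho : R) (N0 : nat) : (0 < d <= 2)%N -> 0 < rho ->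
  0 < M -> exists N L : nat, [/\ (N0 <= N)%N, (2 * L <= N)%N /\ (0 < L)%N,
    (L.*2.+1 ^ d)%:R <= rho * (N.*2.+1 ^ d)%:R,
    M <= kernel_sum L &
    M ^+ 2 * N%:R ^+ 2 <= kernel_sum L ^+ 2 * (N.*2.+1 ^ d)%:R].
Proof.
move=> d12 rho0.
move=> M0; have bound (a : R) : exists n : nat, a <= n%:R /\ (0 < n)%N.
  by exists (Num.truncn a).+1; rewrite ltW// truncnS_gt.
have [d1|d2] : d = 1%N \/ d = 2%N by lia.
  have FE L : kernel_sum L = L%:R.
    rewrite /kernel_sum (eq_bigr (fun=> 1)) ?sumr_const ?card_ord// => k _.
    by rewrite /kernel_coef d1 expr0 invr1.
  have [m [Mm m0]] := bound M; have [i [hi i0]] := bound ((3 * m)%:R / rho).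
  (* With [N = j^2] and [L = m j], the volume ratio is of order [m / j], while [kernel_sum L = L] is
     at least [M sqrt N], as the last condition asks. *)
  pose j := (N0 + 2 * m + i)%N.
  have j0 : (0 < j)%N by rewrite /j; lia.
  have jR : (1 : R) <= j%:R by rewrite ler1n.
  exists (j * j)%N, (m * j)%N; rewrite FE d1 !expn1; split.
  - by rewrite /j; nia.
  - split; last by rewrite muln_gt0 m0.
    by rewrite mulnA leq_mul2r /j; apply/orP; right; lia.
  - have h1 : (3 * m)%:R <= rho * j%:R :> R.
      rewrite mulrC -ler_pdivrMr//; apply: le_trans hi _; rewrite ler_nat /j; lia.
    apply: (@le_trans _ _ (3 * m * j)%:R); first by rewrite ler_nat; nia.
    rewrite natrM; apply: (@le_trans _ _ (rho * j%:R * j%:R)); first by rewrite ler_wpM2r.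
    by rewrite -mulrA -natrM ler_wpM2l ?(ltW rho0)// ler_nat; lia.
  - by apply: le_trans Mm _; rewrite ler_nat leq_pmulr.
  - have M2 : M ^+ 2 <= m%:R ^+ 2 by rewrite lerXn2r// ?nnegrE// ltW.
    apply: (@le_trans _ _ (m%:R ^+ 2 * (j * j)%:R ^+ 2)); first by rewrite ler_wpM2r.
    rewrite -!natrX -!natrM ler_nat; nia.
have [L L0 ML] := kernel_sum_unbounded M d12.
have [i [hi i0]] := bound ((L.*2.+1 ^ 2)%:R / rho).
pose N := (N0 + 2 * L + i)%N; exists N, L; rewrite d2; split => //.
- by rewrite /N; lia.
- by split=> //; rewrite /N; lia.
- apply: (@le_trans _ _ (rho * i%:R)); first by rewrite mulrC -ler_pdivrMr.
  by rewrite ler_wpM2l ?(ltW rho0)// ler_nat /N; nia.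
(* For [d = 2] the volume dominates [N^2], so the last condition reduces to [M <= kernel_sum L]. *)
- apply: ler_pM; rewrite ?exprn_ge0// ?lerXn2r ?nnegrE//; try exact: ltW.
    by apply: le_trans ML; exact: ltW.
  by rewrite -natrX ler_nat leq_exp2r//; lia.
Qed.
End kernel.

(** * Divergence along events of high probability *)

(** A convergent sequence is bounded below, so it lies in some [bad k N0]. Each of these countably
    many sets is covered by sets [S] of arbitrarily small probability, hence negligible. Working
    with covers avoids the measurability of [X N]. *)
Lemma ae_not_cvg (R : realType) (dO : measure_display) (Omega : measurableType dO)
    (P : probability Omega R) (X : nat -> Omega -> R) :
  (forall (k N0 : nat) (delta : R), 0 < delta -> exists2 N, (N0 <= N)%N &
     exists2 S, measurable S /\ (P S <= delta%:E)%E &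
       forall w, ~ S w -> X N w < - k%:R) ->
  {ae P, forall w, ~ exists l : R, (fun N => X N w) @ \oo --> l}.
Proof.
move=> H.
pose bad k N0 := [set w | forall N, (N0 <= N)%N -> - k%:R <= X N w].
have negl k N0 : P.-negligible (bad k N0).
  have /(_ _)/cid2 ex (i : nat) : exists2 S, measurable S /\ (P S <= (i.+1%:R^-1)%:E)%E & bad k N0 `<=` S.
    have [|N NN0 [S mS HS]] := H k N0 i.+1%:R^-1; first by rewrite invr_gt0.
    exists S => // w bw; apply: contrapT => /HS.
    by rewrite ltNge bw.
  pose S i := projT1 (ex i).
  have mS i : measurable (S i) by rewrite /S; case: (ex i) => ? [].
  have PS i : (P (S i) <= (i.+1%:R^-1)%:E)%E by rewrite /S; case: (ex i) => ? [].
  have bS i : bad k N0 `<=` S i by rewrite /S; case: (ex i) => ? [].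
  exists (\bigcap_i S i); split.
  - exact: bigcap_measurable.
  - apply/eqP; rewrite eq_le measure_ge0 andbT; apply/lee_addgt0Pr => e e0.
    rewrite add0e; pose i := Num.truncn e^-1.
    apply: (@le_trans _ _ (P (S i))).
      by apply: le_measure; rewrite ?inE//; [exact: bigcap_measurable|exact: bigcap_inf].
    apply: le_trans (PS i) _; rewrite lee_fin invf_ple ?posrE//.
    by rewrite ltW// truncnS_gt.
  - by move=> w bw i _; exact: bS.
have : P.-negligible (\bigcup_k \bigcup_N0 bad k N0).
  by apply: negligible_bigcup => k; apply: negligible_bigcup => N0.
apply: negligibleS => w /= /contrapT[l Xl].
have /cvgrPdist_lt/(_ 1 ltr01)[N0 _ HN] := Xl.
exists (Num.truncn (`|l| + 1)).+1 => //; exists N0 => // N NN0.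
have := HN N NN0; rewrite /= => h.
have h2 := truncnS_gt (`|l| + 1).
have h3 := ler_norm (l - X N w); have h4 := ler_norm (- l).
rewrite normrN in h4; set r : R := _%:R in h2 *; lra.
Qed.

(** The outer shell is at most a fraction [d / (N + 1)] of the box. Each new dimension adds at most
    one volume, because the side grows by 2 and [2 (N + 1) <= 2 N + 3]. *)
Lemma box_size_shell d N :
  (N.+1 * (N.+1.*2.+1 ^ d - N.*2.+1 ^ d) <= d * N.+1.*2.+1 ^ d)%N.
Proof.
suff H : (N.+1 * N.+1.*2.+1 ^ d <= d * N.+1.*2.+1 ^ d + N.+1 * N.*2.+1 ^ d)%N.
  by rewrite mulnBr; lia.
elim: d => [|d ih]; first by rewrite !expn0; lia.
have le : (N.*2.+1 ^ d <= N.+1.*2.+1 ^ d)%N.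
  by case: d {ih} => // d; rewrite leq_exp2r//; lia.
rewrite !expnS; move: ih le.
move: (N.+1.*2.+1 ^ d)%N (N.*2.+1 ^ d)%N => a b; nia.
Qed.

Lemma vol_gt0 (R : realType) d N : (0 : R) < (N.*2.+1 ^ d)%:R.
Proof. by rewrite ltr0n expn_gt0. Qed.

Lemma le_vol (R : realType) d N : (0 < d)%N -> (N%:R : R) <= (N.*2.+1 ^ d)%:R.
Proof.
move=> d0; have : (N.*2.+1 ^ 1 <= N.*2.+1 ^ d)%N by rewrite leq_pexp2l.
by rewrite ler_nat expn1; lia.
Qed.

Lemma sqr_le_bound (R : realType) (x a : R) : 0 <= a -> x ^+ 2 <= a ^+ 2 -> `|x| <= a.
Proof. by move=> a0; rewrite -(real_normK (num_real x)) ler_pXn2r// nnegrE. Qed.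

(** A constant truncated to the box has gradient only at the outer shell, where each site pays at
    most [2 d c^2]. *)
Lemma shell_energy (R : realType) d (c : R) N : (0 < d)%N ->
  energy N.+1 (fun x : site d => if inbox N.+1 x then c else 0) * N.+1%:R <=
  (2 * d%:R ^+ 2 * c ^+ 2) * (N.+1.*2.+1 ^ d)%:R.
Proof.
move=> d0; pose w r : R := if (r <= N)%N then 0 else (d.*2)%:R * c ^+ 2.
apply: (@le_trans _ _ ((\sum_(x <- box d N.+1) w (linf x)) * N.+1%:R)).
  rewrite ler_wpM2r// /energy big_seq [leRHS]big_seq; apply: ler_sum => x.
  rewrite mem_box => xN; rewrite xN /w linf_inbox.
  have [xN'|xN'] := boolP (inbox N x).
    rewrite big_seq big1// => y yx.
    by rewrite (inbox_nbrs xN' yx) subrr expr0n.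
  apply: (@le_trans _ _ (\sum_(y <- nbrs x) c ^+ 2)).
    apply: ler_sum => y _; case: ifP => _; last by rewrite subr0.
    by rewrite subrr expr0n sqr_ge0.
  by rewrite big_const_seq count_predT iter_addr_0 size_nbrs -[_ *+ _]mulr_natl.
rewrite box_shell [X in X + _]big_seq big1 ?add0r => [|x]; last first.
  by rewrite mem_box /w -linf_inbox => ->.
rewrite /w ltnn -natrB; last by rewrite leq_exp2r//; lia.
have h := box_size_shell d N.
have {}h : (N.+1%:R : R) * (N.+1.*2.+1 ^ d - N.*2.+1 ^ d)%:R <= d%:R * (N.+1.*2.+1 ^ d)%:R by rewrite -!natrM ler_nat.
have c2 : 0 <= (d.*2)%:R * c ^+ 2 by rewrite mulr_ge0// sqr_ge0.
have := ler_wpM2l c2 h; rewrite -muln2 natrM.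
set p := (_ - _)%:R; lra.
Qed.

(** * Fluctuation bounds for the disorder and its pairing with the tilt *)

Section disorder.
Variables (R : realType) (d : nat)
  (dO : measure_display) (Omega : measurableType dO) (P : probability Omega R)
  (xi : site d -> Omega -> R) (u : 'rV[R]_d).
Hypothesis xi_iid : iid_field P xi.
Hypothesis sq_fin : (\int[P]_w ((xi (origin d) w) ^+ 2)%:E < +oo)%E.

Local Notation L1 f := (P.-integrable setT (EFin \o f)).
Local Notation vol N := ((N.*2.+1 ^ d)%:R : R).
Let m := \int[P]_w xi (origin d) w.
Let v := \int[P]_w xi (origin d) w ^+ 2.

Lemma mean_integrable x : L1 (xi x).
Proof.
apply: (@quadratic_integrable _ _ _ P _ _ xi_iid sq_fin 1 (fun t => t)) => // t.
by rewrite mul1r; have := sqr_ge0 (`|t| - 1); have := real_normK (num_real t); nra.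
Qed.

Lemma mean_centered : \int[P]_w (xi (origin d) w - m) = 0.
Proof.
rewrite RintegralB//; first last.
- exact: finite_measure_integrable_cst.
- exact: mean_integrable.
have PT : P setT = 1%E by exact: probability_setT.
rewrite Rintegral_cst// (_ : fine _ = 1) ?mulr1 ?subrr//.
exact: (congr1 fine PT).
Qed.

Lemma abs_sum_bound delta N : 0 < delta ->
  exists2 S, measurable S /\ (P S <= delta%:E)%E & forall w, ~ S w ->
    \sum_(x <- box d N) `|xi x w| <= (1 + (v + 1) / delta) * vol N.
Proof.
move=> dl0.
have v0 : 0 <= v by apply: Rintegral_ge0 => w _; exact: sqr_ge0.
have I2 x : L1 (fun w => xi x w ^+ 2).
  apply: (@quadratic_integrable _ _ _ P _ _ xi_iid sq_fin 1 (fun t => t ^+ 2)) => // t.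
  by rewrite mul1r ger0_norm ?sqr_ge0// lerDr.
have [|||||S mS HS] := @markov_set _ _ _ P (fun w => \sum_(x <- box d N) xi x w ^+ 2) ((v + 1) * vol N) delta.
- exact: integrable_Rsum.
- by move=> w; apply: sumr_ge0 => x _; exact: sqr_ge0.
- by rewrite mulr_gt0 ?vol_gt0// ltr_wpDl.
- exact: dl0.
- rewrite Rintegral_sum// (eq_bigr (fun=> v)) => [|x _]; last first.
    rewrite (@iid_Rintegral _ _ _ P _ _ xi_iid (fun t => t ^+ 2))//.
    exact: (I2 (origin d)).
  rewrite big_const_seq count_predT iter_addr_0 size_box -[_ *+ _]mulr_natr.
  by rewrite ler_wpM2r ?(ltW (vol_gt0 _ _ _))// lerDl.
exists S => // w /HS h.
apply: (@le_trans _ _ (\sum_(x <- box d N) (1 + xi x w ^+ 2))).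
  apply: ler_sum => x _; rewrite -(real_normK (num_real (xi x w))).
  by have := sqr_ge0 (`|xi x w| - 1); have := normr_ge0 (xi x w); nra.
rewrite big_split/= big_const_seq count_predT iter_addr_0 size_box mulrDl mul1r lerD2l.
by rewrite mulrAC ltW.
Qed.

(** By the symmetry of the box the disorder may be centred for free; the variance is then at most of
    order [N^2] per site. [W] does not depend on [N]. *)
Lemma tilt_bound delta : 0 < delta -> exists2 W : R, 0 < W &
  forall N, (0 < N)%N ->
  exists2 S, measurable S /\ (P S <= delta%:E)%E & forall w, ~ S w ->
    (\sum_(x <- box d N) xi x w * psi_u u x) ^+ 2 <= W * vol N * N%:R ^+ 2.
Proof.
move=> dl0.
have mc : measurable_fun setT (fun t : R => t - m) by exact: measurable_funB.
have bc t : (t - m) ^+ 2 <= (2 + 2 * m ^+ 2) * (1 + t ^+ 2).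
  have := sqr_ge0 (t + m); have := mulr_ge0 (sqr_ge0 t) (sqr_ge0 m); nra.
have Ec := mean_centered.
pose v' := \int[P]_w (xi (origin d) w - m) ^+ 2.
have v'0 : 0 <= v' by apply: Rintegral_ge0 => w _; exact: sqr_ge0.
pose U := \sum_i `|u 0 i|.
exists ((U ^+ 2 * v' + 1) / delta).
  by rewrite divr_gt0// ltr_wpDl// mulr_ge0 ?sqr_ge0.
move=> N N0.
have [I E] := variance_sum xi_iid sq_fin (psi_u u) mc bc Ec (uniq_box d N).
have N0R : (0 : R) < N%:R ^+ 2 by rewrite exprn_gt0// ltr0n.
have [||||S mS HS] := @markov_set _ _ _ P _ ((U ^+ 2 * v' + 1) * vol N * N%:R ^+ 2) delta I.
- by move=> w; exact: sqr_ge0.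
- apply: mulr_gt0 => //; apply: mulr_gt0; last exact: vol_gt0.
  by rewrite ltr_wpDl// mulr_ge0// sqr_ge0.
- exact: dl0.
- rewrite E -/v'; apply: (@le_trans _ _ (vol N * (N%:R * U) ^+ 2 * v')).
    rewrite ler_wpM2r//; apply: (@le_trans _ _ (\sum_(x <- box d N) (N%:R * U) ^+ 2)).
      rewrite big_seq [leRHS]big_seq; apply: ler_sum => x; rewrite mem_box.
      exact: psi_u_box.
    by rewrite big_const_seq count_predT iter_addr_0 size_box -[_ *+ _]mulr_natl.
  have : 0 <= vol N * N%:R ^+ 2 by rewrite mulr_ge0// ltW.
  rewrite exprMn; nra.
exists S => // w /HS h.
have -> : \sum_(x <- box d N) xi x w * psi_u u x =
    \sum_(x <- box d N) psi_u u x * (xi x w - m).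
  transitivity (\sum_(x <- box d N) (psi_u u x * (xi x w - m) + m * psi_u u x)).
    by apply: eq_bigr => x _; ring.
  by rewrite big_split/= -mulr_sumr sum_psi_u_box mulr0 addr0.
apply: le_trans (ltW h) _; rewrite le_eqVlt; apply/orP; left; apply/eqP; ring.
Qed.

Lemma sum_bound delta : 0 < delta -> exists2 W : R, 0 < W &
  forall N,
  exists2 S, measurable S /\ (P S <= delta%:E)%E & forall w, ~ S w ->
    (\sum_(x <- box d N) (xi x w - m)) ^+ 2 <= W * vol N.
Proof.
move=> dl0.
have mc : measurable_fun setT (fun t : R => t - m) by exact: measurable_funB.
have bc t : (t - m) ^+ 2 <= (2 + 2 * m ^+ 2) * (1 + t ^+ 2).
  have := sqr_ge0 (t + m); have := mulr_ge0 (sqr_ge0 t) (sqr_ge0 m); nra.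
have Ec := mean_centered.
pose v' := \int[P]_w (xi (origin d) w - m) ^+ 2.
have v'0 : 0 <= v' by apply: Rintegral_ge0 => w _; exact: sqr_ge0.
exists ((v' + 1) / delta); first by rewrite divr_gt0// ltr_wpDl.
move=> N.
have [I E] := variance_sum xi_iid sq_fin (fun=> 1) mc bc Ec (uniq_box d N).
have [||||S mS HS] := @markov_set _ _ _ P _ ((v' + 1) * vol N) delta I.
- by move=> w; exact: sqr_ge0.
- by rewrite mulr_gt0 ?vol_gt0// ltr_wpDl.
- exact: dl0.
- rewrite E -/v' big_const_seq count_predT iter_addr_0 size_box expr1n mulrC.
  by rewrite ler_wpM2r ?(ltW (vol_gt0 _ _ _))// lerDl.
exists S => // w /HS h; rewrite (mulrAC _ _ (vol N)).
by apply: le_trans (ltW h); rewrite le_eqVlt; apply/orP; left; apply/eqP; congr (_ ^+ 2); apply: eq_bigr => x _; rewrite mul1r.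
Qed.
End disorder.

(** * Constant shifts when the mean of the disorder is nonzero *)

Section nonzero_mean.
Variables (R : realType) (d : nat) (V : R -> R) (A B C2 : R)
  (dO : measure_display) (Omega : measurableType dO) (P : probability Omega R)
  (xi : site d -> Omega -> R) (u : 'rV[R]_d).
Hypotheses (A0 : 0 < A) (Vlb : forall s, A * s ^+ 2 - B <= V s).
Hypotheses (C20 : 0 < C2) (Vub : forall s, V s <= V 0 + C2 * s ^+ 2).
Hypothesis xi_iid : iid_field P xi.
Hypothesis sq_fin : (\int[P]_w ((xi (origin d) w) ^+ 2)%:E < +oo)%E.
Hypothesis d0 : (0 < d)%N.

Local Notation vol N := ((N.*2.+1 ^ d)%:R : R).
Let m := \int[P]_w xi (origin d) w.
Let v := \int[P]_w xi (origin d) w ^+ 2.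

(** The shift is [M j] in absolute value on a box of radius [j^2]. Its boundary costs order [M^2]
    per site of the box, while gain and tilt noise are both of order [j] per site; [M] decides
    between these two and [j] then beats the rest. *)
Lemma nonzero_mean_unbounded (k N0 : nat) (delta : R) : m != 0 -> 0 < delta ->
  exists2 N, (N0 <= N)%N &
     exists2 S, measurable S /\ (P S <= delta%:E)%E &
       forall w, ~ S w -> surface_tension V N (fun x => xi x w) u < - k%:R.
Proof.
move=> mn0 dl0; pose dl := delta / 3.
have dl0' : 0 < dl by rewrite divr_gt0.
have [W W0 HW] := tilt_bound u xi_iid sq_fin dl0'.
have [W' W'0 HW'] := sum_bound xi_iid sq_fin dl0'.
have am0 : 0 < `|m| by rewrite normr_gt0.
(* The gain [M |m| j n / 2] covers the tilt noise [(W + 1) j n] and leaves [2 j n], that is [j n]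
   after the prefactor 1/2 of the disorder. *)
pose M := (2 * (W + 1) + 4) / `|m|.
have Mm : M * `|m| = 2 * (W + 1) + 4 by rewrite divfK// gt_eqF.
pose C := vol_const V C2 u + 3 * C2 * (2 * d%:R ^+ 2 * M ^+ 2) + 2^-1 * (1 + (v + 1) / dl).
(* The first entry closes the final inequality; the second keeps the fluctuation of the sum of the
   disorder below half of its mean. *)
pose a := Num.max (C + k%:R) (4 * W' / m ^+ 2).
pose j := (N0 + (Num.truncn a).+1)%N.
have aj : a < j%:R.
  by apply: lt_le_trans (truncnS_gt a) _; rewrite ler_nat leq_addl.
have [aj1 aj2] : C + k%:R < j%:R /\ 4 * W' / m ^+ 2 < j%:R.
  by move: aj; rewrite gt_max => /andP[].
have j0 : (0 < j)%N by rewrite /j addnS.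
have [N NE] : exists N, N.+1 = (j * j)%N by exists (j * j).-1; rewrite prednK// muln_gt0 j0.
exists N.+1.
  by rewrite NE; apply: leq_trans (leq_pmulr j j0); rewrite /j leq_addr.
have [S1 [mS1 PS1] H1] := abs_sum_bound xi_iid sq_fin N.+1 dl0'.
have [S2 [mS2 PS2] H2] := HW N.+1 isT.
have [S3 [mS3 PS3] H3] := HW' N.+1.
exists (S1 `|` (S2 `|` S3)).
  split; first by do 2 apply: measurableU => //.
  apply: le_trans (measureU2 _ _ _) _ => //; first exact: measurableU.
  apply: (@le_trans _ _ (dl%:E + (dl%:E + dl%:E))%E); last first.
    by rewrite -!EFinD lee_fin /dl; lra.
  apply: leeD => //; apply: le_trans (measureU2 _ _ _) _ => //; exact: leeD.
move=> w /not_orP[/H1 {}H1 /not_orP[/H2 {}H2 /H3 {}H3]].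
set n := vol N.+1 in H1 H2 H3; rewrite -/v in H1; rewrite -/m in H3.
have n0 : 0 < n by exact: vol_gt0.
have jR : (1 : R) <= j%:R by rewrite ler1n.
have NR : N.+1%:R = j%:R * j%:R :> R by rewrite NE natrM.
have nN : j%:R * j%:R <= n by rewrite -NR; apply: le_vol.
pose c := - Num.sg m * M * j%:R.
have c2 : c ^+ 2 = M ^+ 2 * (j%:R * j%:R).
  rewrite /c !exprMn sqrrN sqr_sg mn0 mul1r; ring.
pose g (x : site d) : R := if inbox N.+1 x then c else 0.
have Eg : energy N.+1 g <= (2 * d%:R ^+ 2 * M ^+ 2) * n.
  have := shell_energy c N d0; rewrite -/g NR c2 -/n => h.
  have jj : 0 < j%:R * j%:R :> R by nra.
  by rewrite -(ler_pM2r jj); apply: le_trans h _; lra.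
have hg : \sum_(x <- box d N.+1) xi x w * g x <= - (M * `|m| * j%:R * n / 2).
  have -> : \sum_(x <- box d N.+1) xi x w * g x = c * (\sum_(x <- box d N.+1) (xi x w - m) + m * n).
    rewrite sumrB big_const_seq count_predT iter_addr_0 size_box -mulr_natr subrK mulr_sumr.
    by rewrite big_seq [RHS]big_seq; apply: eq_bigr => x; rewrite mem_box /g => ->; rewrite mulrC.
  have h : `|\sum_(x <- box d N.+1) (xi x w - m)| <= `|m| * n / 2.
    apply: sqr_le_bound; first by rewrite divr_ge0// mulr_ge0// ltW.
    apply: le_trans H3 _.
    move: aj2; rewrite ltr_pdivrMr; last by rewrite exprn_even_gt0.
    rewrite -(real_normK (num_real m)) => h4.
    have m2 : 0 < `|m| ^+ 2 by rewrite exprn_gt0.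
    have jn : j%:R <= n by nra.
    have h5 : 4 * W' <= n * `|m| ^+ 2 by have := ler_wpM2r (ltW m2) jn; lra.
    have := ler_wpM2r (ltW n0) h5; rewrite !exprMn exprVn; lra.
  have sgm : Num.sg m * m = `|m| by rewrite normrEsg.
  set D := (\sum_(x <- box d N.+1) (xi x w - m)) in h *.
  have hD : - Num.sg m * D <= `|D|.
    apply: le_trans (ler_norm _) _; rewrite normrM normrN normr_sg mn0 mul1r//.
  have -> : c * (D + m * n) = M * j%:R * (- Num.sg m * D - (Num.sg m * m) * n).
    by rewrite /c; ring.
  rewrite sgm.
  have Mj : 0 <= M * j%:R by rewrite mulr_ge0// /M divr_ge0// addr_ge0// mulr_ge0// addr_ge0// ltW.
  have h6 : - Num.sg m * D - `|m| * n <= - (`|m| * n / 2) by lra.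
  have := ler_wpM2l Mj h6; lra.
have ht : \sum_(x <- box d N.+1) xi x w * psi_u u x <= (W + 1) * j%:R * n.
  apply: le_trans (ler_norm _) _; apply: sqr_le_bound.
    by rewrite !mulr_ge0// ?addr_ge0// ltW.
  apply: le_trans H2 _; rewrite NR.
  have W1 : W <= (W + 1) ^+ 2 by nra.
  have h7 : n * (j%:R * j%:R) ^+ 2 <= (j%:R * j%:R) * n ^+ 2.
    rewrite (_ : n * _ = (j%:R * j%:R) * n * (j%:R * j%:R)); last by ring.
    rewrite (_ : _ * n ^+ 2 = (j%:R * j%:R) * n * n); last by ring.
    by rewrite ler_wpM2l// mulr_ge0// ?ltW// ; nra.
  have := ler_pM (ltW W0) (mulr_ge0 (ltW n0) (sqr_ge0 (j%:R * j%:R))) W1 h7.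
  by rewrite !exprMn; lra.
have gout x : ~~ inbox N.+1 x -> g x = 0 by rewrite /g => /negbTE ->.
have := surface_tension_ub A0 Vlb (ltW C20) Vub u (fun x => xi x w) d0 gout.
rewrite -/n => hst.
rewrite -(ltr_pM2r n0); apply: le_lt_trans hst _.
have h8 := ler_wpM2l (mulr_ge0 (ler0n R 3) (ltW C20)) Eg.
apply: (@le_lt_trans _ _ ((C - j%:R) * n)); last first.
  by rewrite ltr_pM2r//; lra.
move: hg; rewrite Mm => hg; rewrite /C; lra.
Qed.
End nonzero_mean.

(** * Translates of the kernel *)

Lemma ler_sum_subset (R : realType) (T : eqType) (s t : seq T) (G : T -> R) :
  uniq s -> {subset s <= t} -> (forall x, 0 <= G x) ->
  \sum_(x <- s) G x <= \sum_(x <- t) G x.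
Proof.
move=> + + G0; elim: s t => [|x s ih] t; first by rewrite big_nil sumr_ge0.
move=> /= /andP[xs us] st; have xt : x \in t by rewrite st// mem_head.
rewrite big_cons (big_rem x xt)/= lerD2l; apply: ih => // y ys.
have yx : y != x by apply: contraNneq xs => <-.
have := st y; rewrite inE ys orbT => /(_ isT) yt.
by move: yt; rewrite (perm_mem (perm_to_rem xt)) inE (negbTE yx).
Qed.

Section translation.
Variables (R : realType) (d : nat).
Implicit Types x y : site d.

Lemma inbox_add N M x y : inbox N x -> inbox M y -> inbox (N + M) (x + y).
Proof.
move=> /forallP hx /forallP hy; apply/forallP => i.
by move: (hx i) (hy i); rewrite !ffunE; move: (x i) (y i) => a b; lia.
Qed.

Lemma inbox_opp N x : inbox N x -> inbox N (- x).
Proof.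
move=> /forallP hx; apply/forallP => i; have := hx i.
by rewrite !ffunE; move: (x i) => a; lia.
Qed.

Lemma nbrs_sub x y : nbrs (x - y) = [seq z - y | z <- nbrs x].
Proof.
rewrite /nbrs map_flatten; congr flatten; rewrite -[RHS]map_comp; apply: eq_map => i /=.
by congr [:: _; _]; apply/ffunP => j; rewrite !ffunE addrAC.
Qed.

(** The box translated by [- y] stays inside the box of radius [N + M], and all terms are
    nonnegative. *)
Lemma energy_translate N M (f : site d -> R) y : inbox M y ->
  \sum_(x <- box d N) \sum_(z <- nbrs x) (f (x - y) - f (z - y)) ^+ 2 <=
  energy (N + M) f.
Proof.
move=> yM; pose G x := \sum_(z <- nbrs x) (f x - f z) ^+ 2.
rewrite (eq_bigr (fun x => G (x - y))) => [|x _]; last first.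
  by rewrite /G nbrs_sub big_map.
rewrite -(big_map (fun x => x - y) xpredT G); apply: ler_sum_subset.
- by rewrite map_inj_uniq ?uniq_box//; exact: addIr.
- move=> _ /mapP[x xN ->]; rewrite mem_box in xN; rewrite mem_box.
  by apply: inbox_add => //; exact: inbox_opp.
- by move=> x; apply: sumr_ge0 => z _; exact: sqr_ge0.
Qed.

(** Maximum of the kernel times the size of its support. *)
Lemma kernel_fun_sum L N y :
  \sum_(x <- box d N) kernel_fun R L (x - y) <= kernel_sum R d L * (L.*2.+1 ^ d)%:R.
Proof.
rewrite -(big_map (fun x => x - y) xpredT (kernel_fun R L)).
rewrite (bigID (inbox L))/= [X in _ + X]big1 ?addr0; last exact: kernel_fun_out.
rewrite -big_filter; apply: (@le_trans _ _ (\sum_(x <- box d L) kernel_fun R L x)).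
  apply: ler_sum_subset.
  - by rewrite filter_uniq// map_inj_uniq ?uniq_box//; exact: addIr.
  - by move=> x; rewrite mem_filter mem_box => /andP[].
  - exact: kernel_fun_ge0.
apply: (@le_trans _ _ (\sum_(x <- box d L) kernel_sum R d L)).
  by apply: ler_sum => x _; exact: kernel_fun_le.
by rewrite big_const_seq count_predT iter_addr_0 size_box [leRHS]mulr_natr.
Qed.

End translation.

(** * The response field when the mean of the disorder is zero *)

Section zero_mean.
Variables (R : realType) (d : nat)
  (dO : measure_display) (Omega : measurableType dO) (P : probability Omega R)
  (xi : site d -> Omega -> R).
Hypothesis xi_iid : iid_field P xi.
Hypothesis sq_fin : (\int[P]_w ((xi (origin d) w) ^+ 2)%:E < +oo)%E.
Variable b : R -> R.
Hypotheses (mb : measurable_fun setT b) (b1 : forall t, `|b t| <= 1).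
Hypotheses (m0 : \int[P]_w xi (origin d) w = 0)
  (b0 : \int[P]_w b (xi (origin d) w) = 0).

Local Notation vol N := ((N.*2.+1 ^ d)%:R : R).
Let v := \int[P]_w xi (origin d) w ^+ 2.
Let mu := \int[P]_w (xi (origin d) w * b (xi (origin d) w)).

(* The shift [g] of the zero mean case is [- eps] times [response]. *)
Definition response (N L : nat) (w : Omega) (x : site d) : R :=
  \sum_(y <- box d (N - L)) kernel_fun R L (x - y) * b (xi y w).

(** The sources [y] are confined to the box of radius [N - L] and the kernel has range [L]. *)
Lemma response_out N L w x : (L <= N)%N -> ~~ inbox N x -> response N L w x = 0.
Proof.
move=> LN xN; rewrite /response big_seq big1// => y; rewrite mem_box => yN.
rewrite kernel_fun_out ?mul0r//; apply: contra xN => xy.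
by rewrite -(subrK y x) -(subnKC LN); exact: inbox_add.
Qed.

Let b2 t : b t ^+ 2 <= 1.
Proof. by rewrite -(real_normK (num_real (b t))) expr_le1. Qed.

(** The [b (xi y)] are uncorrelated with variance at most 1, so the expected energy is at most the
    sum over [y] of the energies of translated kernels, each at most [36 * kernel_sum]. *)
Lemma response_energy N L delta : (0 < d <= 2)%N -> (0 < L)%N -> 0 < delta ->
  exists2 S, measurable S /\ (P S <= delta%:E)%E & forall w, ~ S w ->
    energy N (response N L w) <= 36 * kernel_sum R d L * vol (N - L) / delta.
Proof.
move=> d12 L0 dl0.
have F1 := kernel_sum_ge1 R d L0.
have bc t : b t ^+ 2 <= 1 * (1 + t ^+ 2).
  by rewrite mul1r; apply: le_trans (b2 t) _; rewrite lerDl sqr_ge0.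
pose cf (x z y : site d) := kernel_fun R L (x - y) - kernel_fun R L (z - y) : R.
have V1 x z := variance_sum xi_iid sq_fin (cf x z) mb bc b0 (uniq_box d (N - L)).
have Ib : \int[P]_w b (xi (origin d) w) ^+ 2 <= 1.
  have -> : 1 = \int[P]_w (1 : R).
    by rewrite Rintegral_cst// (_ : fine _ = 1) ?mulr1//; exact: (congr1 fine (probability_setT P)).
  apply: le_Rintegral => //; last exact: finite_measure_integrable_cst.
  apply: (@quadratic_integrable _ _ _ P _ _ xi_iid sq_fin 1 (fun t => b t ^+ 2)).
    exact: measurable_funX.
  by move=> t; rewrite ger0_norm ?sqr_ge0.
have rE w : energy N (response N L w) = \sum_(x <- box d N) \sum_(z <- nbrs x)
    (\sum_(y <- box d (N - L)) cf x z y * b (xi y w)) ^+ 2.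
  apply: eq_bigr => x _; apply: eq_bigr => z _; congr (_ ^+ 2).
  by rewrite /response -sumrB; apply: eq_bigr => y _; rewrite mulrBl.
have If : P.-integrable setT (EFin \o (fun w => energy N (response N L w))).
  under eq_fun do rewrite rE.
  by apply: integrable_Rsum => x; apply: integrable_Rsum => z; case: (V1 x z).
have [||||S mS HS] := @markov_set _ _ _ P _ (36 * kernel_sum R d L * vol (N - L)) delta If.
- by move=> w; exact: energy_ge0.
- by rewrite mulr_gt0 ?vol_gt0// mulr_gt0// (lt_le_trans ltr01).
- exact: dl0.
- under eq_Rintegral do rewrite rE.
  rewrite Rintegral_sum => [|x]; last by apply: integrable_Rsum => z; case: (V1 x z).
  apply: (@le_trans _ _ (\sum_(x <- box d N) \sum_(z <- nbrs x) \sum_(y <- box d (N - L)) cf x z y ^+ 2)).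
    apply: ler_sum => x _; rewrite Rintegral_sum => [|z]; last by case: (V1 x z).
    apply: ler_sum => z _; rewrite (V1 x z).2 ler_piMr//.
    by apply: sumr_ge0 => y _; exact: sqr_ge0.
  under eq_bigr do rewrite exchange_big /=.
  rewrite exchange_big /=.
  apply: (@le_trans _ _ (\sum_(y <- box d (N - L)) 36 * kernel_sum R d L)).
    rewrite big_seq [leRHS]big_seq; apply: ler_sum => y; rewrite mem_box => yN.
    apply: le_trans (energy_translate N _ yN) _; exact: kernel_energy.
  by rewrite big_const_seq count_predT iter_addr_0 size_box [leRHS]mulr_natr.
by exists S => // w /HS /ltW.
Qed.

(** Boundedness of [b] makes [xi * b(xi)] square integrable, so the variance bound for sums
    applies. *)
Lemma response_diag delta : 0 < delta -> exists2 W : R, 0 < W & forall M,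
  exists2 S, measurable S /\ (P S <= delta%:E)%E & forall w, ~ S w ->
    (\sum_(y <- box d M) (xi y w * b (xi y w) - mu)) ^+ 2 <= W * vol M.
Proof.
move=> dl0; pose kap (t : R) := t * b t - mu.
have mk : measurable_fun setT kap by apply: measurable_funB => //; exact: measurable_funM.
have kc t : kap t ^+ 2 <= (2 + 2 * mu ^+ 2) * (1 + t ^+ 2).
  have h1 : (t * b t) ^+ 2 <= t ^+ 2 by rewrite exprMn ler_piMr// sqr_ge0.
  have := sqr_ge0 (t * b t + mu); have := mulr_ge0 (sqr_ge0 t) (sqr_ge0 mu).
  rewrite /kap; nra.
have Itb : P.-integrable setT (EFin \o (fun w => xi (origin d) w * b (xi (origin d) w))).
  apply: (@quadratic_integrable _ _ _ P _ _ xi_iid sq_fin 1 (fun t => t * b t)).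
    exact: measurable_funM.
  move=> t; rewrite mul1r normrM; apply: (@le_trans _ _ `|t|); first by rewrite ler_piMr.
  by have := sqr_ge0 (`|t| - 1); have := real_normK (num_real t); nra.
have Ek : \int[P]_w kap (xi (origin d) w) = 0.
  rewrite RintegralB//; last exact: finite_measure_integrable_cst.
  rewrite Rintegral_cst// (_ : fine _ = 1) ?mulr1 ?subrr//.
  exact: (congr1 fine (probability_setT P)).
pose v' := \int[P]_w kap (xi (origin d) w) ^+ 2.
have v'0 : 0 <= v' by apply: Rintegral_ge0 => w _; exact: sqr_ge0.
exists ((v' + 1) / delta); first by rewrite divr_gt0// ltr_wpDl.
move=> M.
have [I E] := variance_sum xi_iid sq_fin (fun=> 1) mk kc Ek (uniq_box d M).
have [||||S mS HS] := @markov_set _ _ _ P _ ((v' + 1) * vol M) delta I.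
- by move=> w; exact: sqr_ge0.
- by rewrite mulr_gt0 ?vol_gt0// ltr_wpDl.
- exact: dl0.
- rewrite E -/v' big_const_seq count_predT iter_addr_0 size_box expr1n mulrC.
  by rewrite ler_wpM2r ?(ltW (vol_gt0 _ _ _))// lerDl.
exists S => // w /HS h; rewrite (mulrAC _ _ (vol M)); apply: le_trans (ltW h).
rewrite le_eqVlt; apply/orP; left; apply/eqP; congr (_ ^+ 2).
by apply: eq_bigr => x _; rewrite mul1r.
Qed.

Lemma response_off_diag N L delta : (0 < L)%N -> 0 < delta ->
  exists2 S, measurable S /\ (P S <= delta%:E)%E & forall w, ~ S w ->
    (\sum_(p <- [seq p <- [seq (x, y) | x <- box d N, y <- box d (N - L)] | p.1 != p.2])
       kernel_fun R L (p.1 - p.2) * (xi p.1 w * b (xi p.2 w))) ^+ 2 <=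
    2 * (v + 1) * kernel_sum R d L ^+ 2 * (L.*2.+1 ^ d)%:R * vol (N - L) / delta.
Proof.
move=> L0 dl0; set pairs := [seq p <- _ | _].
have F1 := kernel_sum_ge1 R d L0.
have v0 : 0 <= v by apply: Rintegral_ge0 => w _; exact: sqr_ge0.
have uall : uniq [seq (x, y) | x <- box d N, y <- box d (N - L)].
  by apply: allpairs_uniq; rewrite ?uniq_box// => -[? ?] [? ?] _ _ [-> ->].
pose c (p : site d * site d) := kernel_fun R L (p.1 - p.2).
have [||I E] := @off_diagonal_sqr _ _ _ P _ _ xi_iid sq_fin b mb b1 m0 b0 pairs c
    (kernel_sum R d L) (filter_uniq _ uall).
- by move=> p; rewrite mem_filter => /andP[].
- by move=> p; rewrite kernel_fun_ge0 kernel_fun_le.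
(* One factor [kernel_sum] bounds a weight, the other with the box of radius [L] bounds the sum of
   weights per source. [v + 1] in place of [v] keeps the bound positive. *)
pose bd := 2 * (v + 1) * kernel_sum R d L ^+ 2 * (L.*2.+1 ^ d)%:R * vol (N - L).
have [||||S mS HS] := @markov_set _ _ _ P _ bd delta I.
- by move=> w; exact: sqr_ge0.
- rewrite /bd mulr_gt0 ?vol_gt0// mulr_gt0 ?vol_gt0// mulr_gt0//; first lra.
  by rewrite exprn_gt0// (lt_le_trans ltr01).
- exact: dl0.
- apply: le_trans E _; rewrite -/v.
  have hc : \sum_(p <- pairs) c p <= kernel_sum R d L * (L.*2.+1 ^ d)%:R * vol (N - L).
    apply: (@le_trans _ _ (\sum_(p <- [seq (x, y) | x <- box d N, y <- box d (N - L)]) c p)).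
      rewrite big_filter [leRHS](bigID (fun p => p.1 != p.2))/= lerDl.
      by apply: sumr_ge0 => p _; exact: kernel_fun_ge0.
    rewrite big_allpairs exchange_big /=.
    apply: (@le_trans _ _ (\sum_(y <- box d (N - L)) kernel_sum R d L * (L.*2.+1 ^ d)%:R)).
      by apply: ler_sum => y _; exact: kernel_fun_sum.
    by rewrite big_const_seq count_predT iter_addr_0 size_box [leRHS]mulr_natr.
  have F0 : 0 <= kernel_sum R d L by exact: le_trans F1.
  apply: (@le_trans _ _ (2 * (v + 1) * kernel_sum R d L *
     (kernel_sum R d L * (L.*2.+1 ^ d)%:R * vol (N - L)))).
    apply: ler_pM => //.
    - by rewrite !mulr_ge0.
    - by apply: sumr_ge0 => p _; exact: kernel_fun_ge0.
    - by rewrite ler_wpM2r// ler_wpM2l// lerDl.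
  by rewrite /bd le_eqVlt; apply/orP; left; apply/eqP; ring.
by exists S => // w /HS /ltW.
Qed.

(** Diagonal terms all carry the value of the kernel at the origin; they exist only for sites of the
    smaller box. *)
Lemma response_pairing N L w : (L <= N)%N ->
  \sum_(x <- box d N) xi x w * response N L w x =
  kernel_sum R d L * (\sum_(y <- box d (N - L)) (xi y w * b (xi y w) - mu) + mu * vol (N - L)) +
  \sum_(p <- [seq p <- [seq (x, y) | x <- box d N, y <- box d (N - L)] | p.1 != p.2])
       kernel_fun R L (p.1 - p.2) * (xi p.1 w * b (xi p.2 w)).
Proof.
move=> LN.
pose h (x y : site d) := kernel_fun R L (x - y) * (xi x w * b (xi y w)).
transitivity (\sum_(x <- box d N) \sum_(y <- box d (N - L)) h x y).
  apply: eq_bigr => x _; rewrite /response mulr_sumr; apply: eq_bigr => y _.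
  by rewrite /h mulrCA.
rewrite -(big_allpairs (F := fun p => h p.1 p.2)).
rewrite (bigID (fun p => p.1 != p.2))/= addrC -[X in _ + X = _]big_filter; congr (_ + _).
rewrite big_mkcond big_allpairs exchange_big /=.
rewrite sumrB big_const_seq count_predT iter_addr_0 size_box -[_ *+ (_ ^ _)]mulr_natr subrK mulr_sumr.
rewrite big_seq [RHS]big_seq; apply: eq_bigr => y; rewrite mem_box => yN.
have yN' : y \in box d N by rewrite mem_box; apply: inboxW yN; exact: leq_subr.
rewrite (bigD1_seq y) ?uniq_box//= big1 ?addr0 => [|x /negbTE -> //].
by rewrite eqxx /h subrr -kernel_fun0; congr (kernel_fun _ _ _ * _); apply/ffunP => i; rewrite !ffunE.
Qed.
End zero_mean.

Lemma inner_box_size d N L : (d <= 2)%N -> (2 * L <= N)%N ->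
  (N.*2.+1 ^ d <= 4 * (N - L).*2.+1 ^ d)%N.
Proof.
move=> d2 LN; have h : (N.*2.+1 <= 2 * (N - L).*2.+1)%N by lia.
apply: (@leq_trans (2 ^ d * (N - L).*2.+1 ^ d)); last first.
  by rewrite leq_mul2r (@leq_pexp2l 2 d 2) ?orbT.
rewrite -expnMn; case: (posnP d) => [->|d0]; first by rewrite !expn0.
by rewrite leq_exp2r.
Qed.

(** Write [n], [J], [l] for the volumes of radius [N], [N - L], [L] and [F = kernel_sum L]. The
    pairing lowers the bound by [eps mu F J / 4]; energy takes half of this, and [n <= 4 J] leaves
    [eps mu F n / 32]. The tilt takes half again, and the remaining [eps mu F n / 64] exceeds
    [(C + k + 1) n]. *)
Lemma zero_mean_unbounded (R : realType) (d : nat) (V : R -> R) (A B C2 : R)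
    (dO : measure_display) (Omega : measurableType dO) (P : probability Omega R)
    (xi : site d -> Omega -> R) (u : 'rV[R]_d) (b : R -> R)
    (k N0 : nat) (delta : R) :
  0 < A -> (forall s, A * s ^+ 2 - B <= V s) ->
  0 < C2 -> (forall s, V s <= V 0 + C2 * s ^+ 2) ->
  iid_field P xi ->
  (\int[P]_w ((xi (origin d) w) ^+ 2)%:E < +oo)%E ->
  (0 < d <= 2)%N ->
  measurable_fun setT b -> (forall t, `|b t| <= 1) ->
  \int[P]_w xi (origin d) w = 0 -> \int[P]_w b (xi (origin d) w) = 0 ->
  0 < \int[P]_w (xi (origin d) w * b (xi (origin d) w)) ->
  0 < delta ->
  exists2 N, (N0 <= N)%N &
     exists2 S, measurable S /\ (P S <= delta%:E)%E &
       forall w, ~ S w -> surface_tension V N (fun x => xi x w) u < - k%:R.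
Proof.
move=> A0 Vlb C20 Vub xi_iid sq_fin d12 mb b1 m0 b0.
pose v := \int[P]_w xi (origin d) w ^+ 2.
set mu := (X in 0 < X -> _) => mu0 dl0; pose dl := delta / 5.
have dl0' : 0 < dl by rewrite divr_gt0.
have dlE : delta = dl + (dl + (dl + (dl + dl))) by rewrite /dl; lra.
have v0 : 0 <= v by apply: Rintegral_ge0 => w _; exact: sqr_ge0.
have [W W0 HW] := tilt_bound u xi_iid sq_fin dl0'.
have W1 : W <= (W + 1) ^+ 2 by rewrite sqrrD; have := sqr_ge0 W; lra.
have [W' W'0 HW'] := response_diag xi_iid sq_fin mb b1 dl0'.
pose C := vol_const V C2 u + 2^-1 * (1 + (v + 1) / dl).
have C0 : 0 <= C.
  have h1 : 0 <= \sum_i (u 0 i) ^+ 2 by apply: sumr_ge0 => i _; exact: sqr_ge0.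
  have h2 : 0 <= 3 * C2 * (\sum_i (u 0 i) ^+ 2 + 1).
    by rewrite mulr_ge0// ?mulr_ge0 ?addr_ge0// ltW.
  have h3 : 0 <= vol_const V C2 u by rewrite /vol_const mulr_ge0// addr_ge0.
  have h4 : 0 <= (v + 1) / dl by rewrite divr_ge0 ?addr_ge0// ltW.
  rewrite /C; lra.
(* The 3 stems from [hamiltonian_ub], the 36 from [kernel_energy]; [eps] is then tuned so that the
   energy is at most [eps mu F J / 8]. *)
have [c c0 cE] : exists2 c : R, 0 < c & 3 * 36 = c by exists (3 * 36) => //; lra.
pose eps := mu * dl / (8 * c * C2).
have cC0 : 0 < 8 * c * C2 by apply: mulr_gt0 => //; lra.
have eps0 : 0 < eps by rewrite /eps divr_gt0// mulr_gt0.
have em0 : 0 < eps * mu by rewrite mulr_gt0.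
(* The first summand reduces the tilt to [eps mu F n / 32]; by [M <= F] the second makes
   [eps mu F / 64] at least [C + k + 1]. *)
pose M := (32 * (W + 1) + 64 * (C + k%:R + 1)) / (eps * mu).
have MM : M * (eps * mu) = 32 * (W + 1) + 64 * (C + k%:R + 1) by rewrite divfK// gt_eqF.
have M0 : 0 < M.
  have num0 : 0 < 32 * (W + 1) + 64 * (C + k%:R + 1) by have := ler0n R k; lra.
  by rewrite /M divr_gt0.
(* With [l <= 4 rho J], the two entries make the diagonal fluctuation and the off-diagonal part each
   at most a quarter of the mean [mu F J]. The first entry uses [1 <= l], which forces [J] to be
   large. *)
pose rho := Num.min (mu ^+ 2 / (64 * W')) (mu ^+ 2 * dl / (128 * (v + 1))).
have v1 : 0 < v + 1 by rewrite ltr_wpDl.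
have mu2 : 0 < mu ^+ 2 by rewrite exprn_gt0.
have W64 : 0 < 64 * W' by lra.
have v128 : 0 < 128 * (v + 1) by lra.
have rho0 : 0 < rho by rewrite lt_min !divr_gt0// mulr_gt0.
have [N [L [NN0 [LN2 L0] hrho hM hMN]]] := kernel_scales N0 d12 rho0 M0.
have LN : (L <= N)%N by apply: leq_trans LN2; rewrite leq_pmull.
have N0' : (0 < N)%N by exact: leq_trans L0 LN.
exists N => //.
have [S1 [mS1 PS1] H1] := abs_sum_bound xi_iid sq_fin N dl0'.
have [S2 [mS2 PS2] H2] := HW N N0'.
have [S3 [mS3 PS3] H3] := HW' (N - L)%N.
have [S4 [mS4 PS4] H4] := response_energy xi_iid sq_fin mb b1 b0 N d12 L0 dl0'.
have [S5 [mS5 PS5] H5] := response_off_diag xi_iid sq_fin mb b1 m0 b0 N L0 dl0'.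
exists (S1 `|` (S2 `|` (S3 `|` (S4 `|` S5)))).
  have PU (S T : set Omega) (p q : R) : measurable S /\ (P S <= p%:E)%E ->
      measurable T /\ (P T <= q%:E)%E ->
      measurable (S `|` T) /\ (P (S `|` T) <= (p + q)%:E)%E.
    move=> [mS hS] [mT hT]; split; first exact: measurableU.
    apply: le_trans (measureU2 _ mS mT) _ => //; rewrite EFinD; exact: leeD.
  by rewrite dlE; do 4 apply: (PU) => //.
move=> w /not_orP[/H1 {}H1 /not_orP[/H2 {}H2 /not_orP[/H3 {}H3 /not_orP[/H4 {}H4 /H5 {}H5]]]].
rewrite -/v in H1 H5; rewrite -/mu in H3.
have hX := response_pairing P xi b w LN.
rewrite -/mu in hX.
set D := (\sum_(y <- box d (N - L)) (xi y w * b (xi y w) - mu)) in H3 hX.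
set O := (\sum_(p <- _) _) in H5 hX.
have n0 : 0 < (N.*2.+1 ^ d)%:R :> R by exact: vol_gt0.
have J0 : 0 < ((N - L).*2.+1 ^ d)%:R :> R by exact: vol_gt0.
have F1 := kernel_sum_ge1 R d L0.
have nJ : (N.*2.+1 ^ d)%:R <= 4 * ((N - L).*2.+1 ^ d)%:R :> R.
  by rewrite -natrM ler_nat; apply: inner_box_size => //; case/andP: d12.
have l1 : 1 <= (L.*2.+1 ^ d)%:R :> R by rewrite ler1n expn_gt0.
have rho1 : rho <= mu ^+ 2 / (64 * W') by rewrite ge_min lexx.
have rho2 : rho <= mu ^+ 2 * dl / (128 * (v + 1)) by rewrite ge_min lexx orbT.
rewrite ler_pdivlMr// in rho1.
rewrite ler_pdivlMr// in rho2.
set n : R := (N.*2.+1 ^ d)%:R in hrho hM hMN H2 nJ n0 H1.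
set J : R := ((N - L).*2.+1 ^ d)%:R in nJ J0 H3 H4 H5 hX.
set l : R := (L.*2.+1 ^ d)%:R in hrho l1 H5.
set F := kernel_sum R d L in hM hMN H4 H5 F1 hX.
have rJ : l <= rho * (4 * J) by apply: le_trans hrho _; rewrite ler_wpM2l// ltW.
have hD : `|D| <= mu * J / 4.
  apply: sqr_le_bound; first by rewrite divr_ge0// mulr_ge0// ltW.
  apply: le_trans H3 _.
  have h1 : 16 * W' <= mu ^+ 2 * J.
    have h2 : 1 <= rho * (4 * J) by exact: le_trans rJ.
    have h3 := ler_wpM2l (ltW W64) h2.
    by move: h3 (ler_wpM2r (ltW J0) rho1); clear; lra.
  by move: (ler_wpM2r (ltW J0) h1); rewrite !exprMn exprVn; clear; lra.
have hO : `|O| <= mu * F * J / 4.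
  apply: sqr_le_bound.
    by rewrite divr_ge0// !mulr_ge0// ?(ltW mu0)// ?(ltW J0)// (le_trans ler01).
  apply: le_trans H5 _; rewrite ler_pdivrMr//.
  have h1 : 32 * (v + 1) * l <= mu ^+ 2 * dl * J.
    have h2 := ler_wpM2l (ltW v128) rJ.
    by move: h2 (ler_wpM2r (ltW J0) rho2); clear; lra.
  have FJ : 0 <= F ^+ 2 * J by rewrite mulr_ge0 ?sqr_ge0// ltW.
  by move: (ler_wpM2r FJ h1); rewrite !exprMn exprVn; clear; lra.
have hX2 : mu * F * J / 2 <= \sum_(x <- box d N) xi x w * response xi b N L w x.
  rewrite hX; have := ler_norm (- O); have := ler_norm (- D); rewrite !normrN => h1 h2.
  have F0 : 0 <= F by exact: le_trans F1.
  have h3 : 3 / 4 * (mu * J) <= D + mu * J by move: hD h1; clear; lra.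
  by move: (ler_wpM2l F0 h3) hO h2; clear; lra.
pose g x := - eps * response xi b N L w x.
have gout x : ~~ inbox N x -> g x = 0.
  by move=> xN; rewrite /g response_out ?mulr0.
have Eg : energy N g = eps ^+ 2 * energy N (response xi b N L w).
  rewrite /energy mulr_sumr; apply: eq_bigr => x _; rewrite mulr_sumr.
  by apply: eq_bigr => y _; rewrite /g -mulrBr exprMn sqrrN.
have hg : \sum_(x <- box d N) xi x w * g x <= - (eps * (mu * F * J / 2)).
  have -> : \sum_(x <- box d N) xi x w * g x =
      - (eps * \sum_(x <- box d N) xi x w * response xi b N L w x).
    by rewrite mulr_sumr -sumrN; apply: eq_bigr => x _; rewrite /g; ring.
  by rewrite lerN2 ler_wpM2l// ltW.
have ht : \sum_(x <- box d N) xi x w * psi_u u x <= (W + 1) * F * n / M.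
  apply: le_trans (ler_norm _) _; apply: sqr_le_bound.
    by rewrite divr_ge0 ?(ltW M0)// !mulr_ge0 ?(ltW n0)// ?addr_ge0 ?(ltW W0)// (le_trans ler01).
  apply: le_trans H2 _.
  have M20 : 0 < M ^+ 2 by rewrite exprn_gt0.
  rewrite !exprMn exprVn ler_pdivlMr//.
  have h7 := ler_wpM2r (ltW n0) hMN.
  have q0 : 0 <= M ^+ 2 * N%:R ^+ 2 * n by apply: mulr_ge0; [rewrite mulr_ge0 ?sqr_ge0|exact: ltW].
  by move: (ler_pM (ltW W0) q0 W1 h7); clear; lra.
have henergy : 3 * C2 * energy N g <= eps * mu * F * J / 8.
  rewrite Eg.
  have ce0 : 0 <= 3 * C2 * eps ^+ 2.
    by apply: mulr_ge0; [apply: mulr_ge0 => //; exact: ltW|exact: sqr_ge0].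
  have := ler_wpM2l ce0 H4.
  have -> : 3 * C2 * eps ^+ 2 * (36 * F * J / dl) = eps * mu * F * J / 8.
    rewrite (_ : 3 * C2 * _ * _ = (3 * 36) * (C2 * eps ^+ 2 * F * J / dl)); last by ring.
    by rewrite cE /eps; field; rewrite !gt_eqF.
  by apply: le_trans; rewrite mulrA.
have d0 : (0 < d)%N by case/andP: d12.
have := surface_tension_ub A0 Vlb (ltW C20) Vub u (fun x => xi x w) d0 gout.
rewrite -/n => hst.
rewrite -(ltr_pM2r n0); apply: le_lt_trans hst _.
have eF0 : 0 <= eps * mu * F by rewrite mulr_ge0 ?(ltW em0)// (le_trans ler01).
have hJ := ler_wpM2l eF0 nJ.
have hF : (W + 1) * F * n / M <= eps * mu * F * n / 32.
  rewrite ler_pdivrMr// [leRHS](_ : _ = (M * (eps * mu)) * (F * n) / 32); last by ring.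
  rewrite MM.
  have Fn : 0 <= F * n by rewrite mulr_ge0 ?(ltW n0)// (le_trans ler01).
  have Ck : 0 <= C + k%:R + 1 by apply: addr_ge0 => //; exact: addr_ge0.
  by move: (mulr_ge0 Ck Fn); clear; lra.
have hlast : (C + k%:R + 1) * n <= eps * mu * F * n / 64.
  have h1 : C + k%:R + 1 <= eps * mu * F / 64.
    move: (ler_wpM2l (ltW em0) hM) W0 C0 (ler0n R k); rewrite (mulrC _ M) MM; clear; lra.
  by move: (ler_wpM2r (ltW n0) h1); clear; lra.
apply: (@le_lt_trans _ _ ((- k%:R - 1) * n)); last first.
  by rewrite ltr_pM2r// ltrBlDr ltrDl.
move: hlast H1 hg henergy ht hF hJ; rewrite /C; clear; lra.
Qed.

(** Take [T t = t / (1 + t^2)], bounded by 1/2 and of the sign of [t], and subtract its mean. As [X]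
    is centred, this subtraction leaves [E (X T(X))] unchanged. *)
Lemma bounded_proxy (R : realType) (dO : measure_display) (Omega : measurableType dO)
    (P : probability Omega R) (X : Omega -> R) :
  measurable_fun setT X -> P.-integrable setT (EFin \o X) ->
  \int[P]_w X w = 0 -> (\int[P]_w ((X w) ^+ 2)%:E != 0)%E ->
  exists b : R -> R, [/\ measurable_fun setT b, forall t, `|b t| <= 1,
    \int[P]_w b (X w) = 0 & 0 < \int[P]_w (X w * b (X w))].
Proof.
move=> mX IX X0 Xn0.
pose T (t : R) := t / (1 + t ^+ 2).
have pos t : 0 < 1 + t ^+ 2 :> R by rewrite ltr_pwDl ?sqr_ge0.
have mT : measurable_fun setT T.
  apply: continuous_measurable_fun => t.
  apply: (@continuousM R R (fun t => t) (fun t => (1 + t ^+ 2)^-1)); first exact: cvg_id.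
  apply: (@continuousV R R (fun t => 1 + t ^+ 2)); first by rewrite gt_eqF.
  by apply: continuousD; [exact: cst_continuous|exact: exprn_continuous].
have T2 t : `|T t| <= 1 / 2.
  rewrite /T normrM normfV (gtr0_norm (pos t)) ler_pdivrMr//.
  have := sqr_ge0 (`|t| - 1); rewrite -(real_normK (num_real t)); nra.
have mTX : measurable_fun setT (fun w => T (X w)) by exact: measurableT_comp.
have IT : P.-integrable setT (EFin \o (fun w => T (X w))).
  apply: (@integrableW _ _ _ _ _ (fun=> 1 / 2)) => //.
  exact: finite_measure_integrable_cst.
have PT : fine (P setT) = 1 by exact: (congr1 fine (probability_setT P)).
pose e := \int[P]_w T (X w).
have e2 : `|e| <= 1 / 2.
  apply: le_trans (le_normr_Rintegral measurableT IT) _.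
  have -> : 1 / 2 = \int[P]_w (1 / 2 : R) by rewrite Rintegral_cst// PT mulr1.
  apply: le_Rintegral => //; first exact: integrable_norm.
  exact: finite_measure_integrable_cst.
exists (fun t => T t - e); split.
- exact: measurable_funB.
- by move=> t; apply: le_trans (ler_normB _ _) _; have := T2 t; lra.
- rewrite RintegralB//; last exact: finite_measure_integrable_cst.
  by rewrite Rintegral_cst// PT mulr1 subrr.
have mXT : measurable_fun setT (fun w => X w * T (X w)) by exact: measurable_funM.
have XT0 w : 0 <= X w * T (X w).
  by rewrite /T mulrA -expr2 divr_ge0 ?sqr_ge0// ltW.
have IXT : P.-integrable setT (EFin \o (fun w => X w * T (X w))).
  apply: (@integrableW _ _ _ _ _ (fun w => `|X w|)) => //; last exact: integrable_norm.
  move=> w; rewrite normrM ler_piMr//; apply: le_trans (T2 _) _; lra.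
under eq_Rintegral do rewrite mulrBr.
have IXe : P.-integrable setT (EFin \o (fun w => X w * e)).
  have := integrableZr measurableT e IX; by congr (integrable _ _ _).
rewrite RintegralB// RintegralZr// X0 mul0r subr0.
(* If the nonnegative [X T(X) = X^2 / (1 + X^2)] had integral 0, it would vanish almost everywhere,
   and so would [X^2]. *)
rewrite lt_neqAle Rintegral_ge0// andbT; apply: contra Xn0 => /eqP E.
have mXTE : measurable_fun setT (EFin \o (fun w => X w * T (X w))) by exact/measurable_EFinP.
have mX2 : measurable_fun setT (fun w => ((X w) ^+ 2)%:E).
  by apply/measurable_EFinP; exact: measurable_funX.
have := ae_eq_integral_abs P measurableT mXTE.
under eq_integral do rewrite /= ger0_norm//.
have -> : (\int[P]_x (X x * T (X x))%:E = 0)%E.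
  have := integrable_fin_num measurableT IXT; rewrite /comp => /fineK <-.
  by rewrite -/(Rintegral _ _ _) -E.
case=> /(_ erefl) ae0 _.
rewrite (@ae_eq_integral _ _ _ P setT (cst 0%E))//; first by rewrite integral0.
apply: filterS ae0 => w /= /(_ Logic.I) [h] _.
congr (_%:E); move/eqP: h; rewrite /T mulrA -expr2 mulf_eq0 invr_eq0.
by rewrite (gt_eqF (pos _)) orbF => /eqP.
Qed.

Theorem theorem1p3 (R : realType) (d : nat) (V : R -> R) (A B C2 : R)
    (dO : measure_display) (Omega : measurableType dO) (P : probability Omega R)
    (xi : site d -> Omega -> R) :
  (forall s, V (- s) = V s) ->
  (forall s, derivable V s 1) -> (forall s, derivable V^`() s 1) ->
  continuous V^`(2) ->
  0 < A -> (forall s, A * s ^+ 2 - B <= V s) ->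
  0 < C2 -> (forall s, V^`(2) s <= C2) ->
  iid_field P xi ->
  (\int[P]_w ((xi (origin d) w) ^+ 2)%:E < +oo)%E ->
  (\int[P]_w ((xi (origin d) w) ^+ 2)%:E != 0)%E ->
  (d = 1%N \/ d = 2%N \/ (3 <= d)%N /\ (\int[P]_w (xi (origin d) w)%:E != 0)%E) ->
  forall u : 'rV[R]_d,
    {ae P, forall w, ~ exists l : R,
        (fun N : nat => surface_tension V N (fun x => xi x w) u) @ \oo --> l}.
Proof.
move=> Ve Vd Vdd _ A0 Vlb C20 V2 xi_iid sq_fin sq0 d_or u.
have Vub := even_quadratic_ub Ve Vd Vdd (ltW C20) V2.
have d0 : (0 < d)%N by case: d_or => [->|[->|[h _]]] //; exact: leq_trans h.
have mX : measurable_fun setT (xi (origin d)) by case: xi_iid.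
have IX := mean_integrable xi_iid sq_fin (origin d).
have XE : (\int[P]_w (xi (origin d) w)%:E = (\int[P]_w xi (origin d) w)%:E)%E.
  by rewrite /Rintegral fineK//; exact: integrable_fin_num.
apply: ae_not_cvg => k N0 delta dl0.
have [m0|mn0] := eqVneq (\int[P]_w xi (origin d) w) 0; last first.
  exact: (nonzero_mean_unbounded u A0 Vlb C20 Vub xi_iid sq_fin d0).
have d12 : (0 < d <= 2)%N.
  by case: d_or => [->|[->|[_]]] //; rewrite XE m0 eqxx.
have [b [mb b1 b0 mu0]] := bounded_proxy mX IX m0 sq0.
exact: (zero_mean_unbounded u k N0 A0 Vlb C20 Vub xi_iid sq_fin d12 mb b1 m0 b0 mu0 dl0).
Qed.
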